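(* Consider the model $y=X\beta^*+W$ with $M\ge2$, $N\ge1$, where $W\in\mathbb{R}^N$ has i.i.d. $\mathcal{N}(0,\sigma^2)$ components, $\sigma^2>0$. Let $q>0$ and, for every $j\in\mathbb{N}_M$, $$\lambda_j\ \ge\ \frac{2\sigma}{\sqrt N}\sqrt{\mathrm{tr}(\Psi_j)+2\,|||\Psi_j|||\,\bigl(2q\log M+\sqrt{K_j\,q\log M}\bigr)}.$$ Assume that $M(\beta^* )\le s$ and that Assumption RE($s$) holds, and let the Coherence Assumption hold with the same $s$ and with constants $\alpha>1$ and $\phi>0$. Then with probability at least $1-2M^{1-q}$, for any solution $\hat\beta$ of the Group Lasso problem (GL) and any $1\le p<\infty$ we have $$\|\hat\beta-\beta^*\|_{2,p}\le\frac{c_1}\phi\lambda_{\max}\Bigl(\sum_{j\in J(\beta^* )}\frac{\lambda_j^2}{\lambda_{\min}\lambda_{\max}}\Bigr)^{1/p},$$ where $$c_1=\Bigl(\frac{16\alpha}{\alpha-1}\Bigr)^{1/p}\Bigl(\frac32+\frac{16}{7(\alpha-1)}\Bigr)^{1-\frac1p}.$$ If, in addition, $\min_{j\in J(\beta^* )}\|(\beta^* )^j\|>\frac{2c}\phi\lambda_{\max}$ with $c=\frac32+\frac{16}{7(\alpha-1)}$, then with the same probability for any solution $\hat\beta$ of (GL) and any $1\le p<\infty$ we have $$\|\hat\beta-\beta^*\|_{2,p}\le\frac{c_1}\phi\lambda_{\max}\Bigl(\sum_{j\in\hat J}\frac{\lambda_j^2}{\lambda_{\min}\lambda_{\max}}\Bigr)^{1/p},$$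 where $\hat J=\{j:\ \|\hat\beta^j\|>\frac c\phi\lambda_{\max}\}$.
   Context: For a positive integer $\ell$, $\mathbb{N}_\ell=\{1,\dots,\ell\}$. Let $M\le K$ and let $G_1,\dots,G_M$ be a prescribed partition of $\mathbb{N}_K$, with $K_j=|G_j|$. $X$ is a deterministic real $N\times K$ matrix, $\mathbf{X}_{G_j}$ is the $N\times K_j$ submatrix of columns indexed by $G_j$, $\Psi_j=\mathbf{X}_{G_j}^\top\mathbf{X}_{G_j}/N$, and $\Psi[j,j']=\frac1N\mathbf{X}_{G_j}^\top\mathbf{X}_{G_{j'}}$, with $(t,t')$ entry $(\Psi[j,j'])_{t,t'}$, $t\in\mathbb{N}_{K_j}$, $t'\in\mathbb{N}_{K_{j'}}$. For a symmetric positive semidefinite $A$, $\mathrm{tr}(A)$ is the trace and $|||A|||$ the spectral norm. For $\beta\in\mathbb{R}^K$: $\beta^j=(\beta_k:k\in G_j)$; $\|\cdot\|$ is the Euclidean norm; $\|\beta\|_{2,p}=(\sum_{j=1}^M\|\beta^j\|^p)^{1/p}$ for $1\le p<\infty$; $J(\beta)=\{j\in\mathbb{N}_M:\beta^j\ne0\}$; $M(\beta)=|J(\beta)|$. For $J\subseteq\mathbb{N}_M$, $\beta_J$ has blocks $\beta^j$ for $j\in J$ and $0$ for $j\notin J$; $J^c=\mathbb{N}_M\setminus J$. Group Lasso problem (GL), with positive parameters $\lambda_1,\dots,\lambda_M$; $\lambda_{\min}=\min_j\lambda_j$, $\lambda_{\max}=\max_j\lambda_j$: $$\min\Bigl\{\frac1N\|X\beta-y\|^2+2\sum_{j=1}^M\lambda_j\|\beta^j\|:\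 \beta\in\mathbb{R}^K\Bigr\}.$$ $s$ is an integer, $1\le s\le M$. Assumption RE($s$): there exists $\kappa=\kappa(s)>0$ such that $$\min\Bigl\{\frac{\|X\Delta\|}{\sqrt N\|\Delta_J\|}:\ |J|\le s,\ \Delta\in\mathbb{R}^K\setminus\{0\},\ \sum_{j\in J^c}\lambda_j\|\Delta^j\|\le3\sum_{j\in J}\lambda_j\|\Delta^j\|\Bigr\}\ge\kappa .$$ Coherence Assumption (with $s$, $\alpha$, $\phi$): (1) for any $j\in\mathbb{N}_M$ and $t\in\mathbb{N}_{K_j}$, $(\Psi[j,j])_{t,t}=\phi$, and $$\max_{1\le t,t'\le K_j,\,t\ne t'}|(\Psi[j,j])_{t,t'}|\le\frac{\lambda_{\min}\phi}{14\alpha\lambda_{\max}s}\,\frac1{K_j};$$ (2) for any $j\ne j'\in\mathbb{N}_M$, $$\max_{1\le t\le\min(K_j,K_{j'})}|(\Psi[j,j'])_{t,t}|\le\frac{\lambda_{\min}\phi}{14\alpha\lambda_{\max}s}$$ and $$\max_{1\le t\le K_j,\,1\le t'\le K_{j'},\,t\ne t'}|(\Psi[j,j'])_{t,t'}|\le\frac{\lambda_{\min}\phi}{14\alpha\lambda_{\max}s}\,\frac1{\sqrt{K_jK_{j'}}}.$$ *)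

(* Defs.v *)
From HB Require Import structures.
From mathcomp Require Import all_boot all_order all_algebra.
From mathcomp Require Import all_classical all_reals all_analysis.

Set Implicit Arguments.
Unset Strict Implicit.
Unset Printing Implicit Defensive.

Import Order.TTheory GRing.Theory Num.Theory.

Local Open Scope ring_scope.

Definition enorm {R : realType} {n : nat} (v : 'cV[R]_n) : R :=
  Num.sqrt (\sum_i v i 0 ^+ 2).

(* The operator norm induced by the Euclidean norm. *)
Definition spectral_norm {R : realType} {n : nat} (A : 'M[R]_n) : R :=
  sup [set enorm (A *m v) | v in [set v : 'cV[R]_n | enorm v <= 1]]%classic.

Section Groups.
Context {R : realType} {N K M : nat}.
Implicit Types (G : 'I_M -> {set 'I_K}) (X : 'M[R]_(N, K)) (b : 'cV[R]_K).

(* G 0, ..., G (M - 1) are pairwise distinct, hence pairwise disjoint; they are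
   nonempty and cover 'I_K. *)
Definition is_group_partition G : Prop :=
  injective G /\ finset.partition (G @: 'I_M)%SET [set: 'I_K]%SET.

(* [enum_val] lists G j in increasing order, so that the entries of a group are
   numbered by 'I_#|G j| in their natural order. *)
Definition group_cols G X j : 'M[R]_(N, #|G j|) :=
  colsub (@enum_val _ (mem (G j))) X.

Definition group_block G b j : 'cV[R]_#|G j| :=
  rowsub (@enum_val _ (mem (G j))) b.

Definition restrict_groups G (J : {set 'I_M}) b : 'cV[R]_K :=
  \col_k (if [exists j in J, k \in G j] then b k 0 else 0).

Definition group_supp G b : {set 'I_M} :=
  [set j | group_block G b j != 0]%SET.

Definition mixed_norm G (p : R) b : R :=
  (\sum_j enorm (group_block G b j) `^ p) `^ p^-1.

Definition cross_gram G X j j' : 'M[R]_(#|G j|, #|G j'|) :=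
  N%:R^-1 *: ((group_cols G X j)^T *m group_cols G X j').

Definition gram G X j : 'M[R]_#|G j| := cross_gram G X j j.

Section Penalty.
Variable lam : 'I_M -> R.

(* Both are the true extrema as soon as 0 < M and the lam j are positive. *)
Definition lambda_max : R := \big[Num.max/0]_j lam j.
Definition lambda_min : R := \big[Num.min/lambda_max]_j lam j.

Definition GL_objective G X (y : 'cV[R]_N) b : R :=
  N%:R^-1 * enorm (X *m b - y) ^+ 2
  + 2 * \sum_j lam j * enorm (group_block G b j).

Definition GL_solution G X (y : 'cV[R]_N) (bhat : 'cV[R]_K) : Prop :=
  forall b, GL_objective G X y bhat <= GL_objective G X y b.

(* The constraints force the restriction of D to J to be nonzero when the
   lam j are positive. *)
Definition RE G X (s : nat) : Prop :=
  exists2 kappa : R, 0 < kappa &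
    forall (J : {set 'I_M}) (D : 'cV[R]_K),
      (#|J| <= s)%N -> D != 0 ->
      \sum_(j in ~: J) lam j * enorm (group_block G D j)
        <= 3 * \sum_(j in J) lam j * enorm (group_block G D j) ->
      kappa <= enorm (X *m D)
               / (Num.sqrt N%:R * enorm (restrict_groups G J D)).

Definition coherence_level (s : nat) (alpha phi : R) : R :=
  lambda_min * phi / (14 * alpha * lambda_max * s%:R).

(* In the last two clauses t and t' range over different ordinal types and are
   compared as natural numbers. *)
Definition coherence G X (s : nat) (alpha phi : R) : Prop :=
  [/\ (forall j (t : 'I_#|G j|), gram G X j t t = phi),
      (forall j (t t' : 'I_#|G j|), t != t' ->
         `|gram G X j t t'| <= coherence_level s alpha phi * (#|G j|%:R)^-1),
      (forall j j', j != j' -> forall (t : 'I_#|G j|) (t' : 'I_#|G j'|),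
         t = t' :> nat ->
         `|cross_gram G X j j' t t'| <= coherence_level s alpha phi) &
      (forall j j', j != j' -> forall (t : 'I_#|G j|) (t' : 'I_#|G j'|),
         t <> t' :> nat ->
         `|cross_gram G X j j' t t'|
           <= coherence_level s alpha phi
              * (Num.sqrt (#|G j|%:R * #|G j'|%:R))^-1)].

End Penalty.

End Groups.

Section Probability.
Context {d : measure_display} {T : measurableType d} {R : realType}.
Variable P : probability T R.

(* Mutual independence: the product rule over every subfamily. *)
Definition mutually_independent {n : nat} (W : 'I_n -> {RV P >-> R}) : Prop :=
  forall (I : {set 'I_n}) (B : 'I_n -> set R),
    (forall i, measurable (B i)) ->
    P (\bigcap_(i in [set` I]) (W i @^-1` B i))%classic
    = (\prod_(i in I) P (W i @^-1` B i)%classic)%E.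

(* [normal_prob m sigma] takes the standard deviation as second parameter. *)
Definition iid_centered_normal {n : nat} (W : 'I_n -> {RV P >-> R}) (sigma : R)
    : Prop :=
  mutually_independent W /\
  forall i (A : set R), measurable A ->
    distribution P (W i) A = normal_prob 0 sigma A.

(* E need not be measurable itself. *)
Definition holds_with_prob_ge (r : R) (E : set T) : Prop :=
  exists A : set T, [/\ measurable A, (A `<=` E)%classic & (r%:E <= P A)%E].

End Probability.

Definition gl_c {R : realType} (alpha : R) : R :=
  3 / 2 + 16 / (7 * (alpha - 1)).

Definition gl_c1 {R : realType} (alpha p : R) : R :=
  (16 * alpha / (alpha - 1)) `^ p^-1 * gl_c alpha `^ (1 - p^-1).

(* The right-hand side of the bounds, the sum being taken over J. *)
Definition gl_bound {R : realType} {M : nat} (lam : 'I_M -> R) (alpha phi p : R)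
    (J : {set 'I_M}) : R :=
  gl_c1 alpha p / phi * lambda_max lam
  * (\sum_(j in J) lam j ^+ 2 / (lambda_min lam * lambda_max lam)) `^ p^-1.

(* Main.v *)
(* On the event where every group noise satisfies |X_j^T W| / N <= lam j / 2,
   optimality of bhat gives, for D := bhat - bstar, the stationarity bound
   |X_j^T X D| / N <= (3/2) lam j and the cone inequality.  Coherence makes the
   Gram matrix phi times the identity up to blocks of norm at most twice the
   coherence level: stationarity then bounds every block of D, and the cone
   inequality bounds the sum of their norms.  The l_p bound is the interpolation
   between these two.

   For the event, |X_j^T W|^2 is a sum of squares of orthogonal linear forms in
   W after diagonalising the Gram matrix; its exponential moment is computed by
   writing each exp (S^2 / 2) as a normal average of exp (z S), and Chernoff's
   bound with the parameter of Laurent and Massart gives exp (- q ln M) per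
   group. *)
Require Import Defs.
From HB Require Import structures.
From mathcomp Require Import all_boot all_order all_algebra.
From mathcomp Require Import all_classical all_reals all_analysis.
From mathcomp Require Import measurable_realfun complex ring lra.

Set Implicit Arguments.
Unset Strict Implicit.
Unset Printing Implicit Defensive.

Import Order.TTheory GRing.Theory Num.Theory.

Local Open Scope ring_scope.

(** * Diagonalisation of real symmetric matrices *)

(** Two gaps shape the probabilistic half. Independence is given as a product rule for events, so it
    has to be lifted to expectations of products of functions of single coordinates. A square of a
    linear form is not such a product, because every form involves all coordinates of the noise.
    Averaging exp (z S) over a normal z makes the exponent linear in the noise, hence factorisable
    over its coordinates, and no rotation invariance of the Gaussian law is invoked. In the
    deterministic half the cone inequality is weighted by the [lam j], whereas the Gram estimate
    involves unweighted sums of block norms. The ratio of [lambda_min] to [lambda_max] in the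
    coherence level pays for the passage from one to the other. *)

Lemma row_sqnorm_ge0 (R : realType) n (v : 'rV[R]_n) : 0 <= (v *m v^T) 0 0.
Proof. by rewrite mxE; apply: sumr_ge0 => i _; rewrite mxE -expr2 sqr_ge0. Qed.

Lemma row_sqnorm_gt0 (R : realType) n (v : 'rV[R]_n) :
  v != 0 -> 0 < (v *m v^T) 0 0.
Proof.
move=> v0; rewrite lt_neqAle row_sqnorm_ge0 andbT eq_sym mxE.
apply: contra v0; rewrite psumr_eq0 => [|i _]; last by rewrite mxE -expr2 sqr_ge0.
move=> /allP h; apply/eqP/rowP => i; rewrite mxE.
by have := h i (mem_index_enum _); rewrite mxE mulf_eq0 orbb => /eqP.
Qed.

(* Pairing the real and imaginary parts of a complex eigenvector through A
   shows that the imaginary part of the eigenvalue vanishes. *)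
Lemma symmetric_eigenvalue (R : realType) n (A : 'M[R]_n.+1) :
  A^T = A -> exists a, eigenvalue A a.
Proof.
move=> sA.
have [a /eigenvalueP[v vA v0]] :=
  eigenvalue_closed (map_mx (real_complex R) A) (ltn0Sn n).
pose x := \row_i complex.Re (v 0 i); pose z := \row_i complex.Im (v 0 i).
have ReE (c d : R[i]) : complex.Re (c + d) = complex.Re c + complex.Re d by case: c d => ? ? [].
have ImE (c d : R[i]) : complex.Im (c + d) = complex.Im c + complex.Im d by case: c d => ? ? [].
have Resum (F : 'I_n.+1 -> R[i]) : complex.Re (\sum_i F i) = \sum_i complex.Re (F i).
  by apply: (big_morph (@complex.Re R)).
have Imsum (F : 'I_n.+1 -> R[i]) : complex.Im (\sum_i F i) = \sum_i complex.Im (F i).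
  by apply: (big_morph (@complex.Im R)).
have xA : x *m A = complex.Re a *: x - complex.Im a *: z.
  apply/rowP => j; have /rowP/(_ j) := vA.
  rewrite !mxE => /(congr1 (@complex.Re R)); rewrite Resum.
  move=> e; transitivity (complex.Re (a * v 0 j)); last by case: (a) (v 0 j) => ? ? [].
  rewrite -e; apply: eq_bigr => i _; rewrite !mxE.
  by case: (v 0 i) => p q /=; rewrite mulr0 subr0.
have zA : z *m A = complex.Re a *: z + complex.Im a *: x.
  apply/rowP => j; have /rowP/(_ j) := vA.
  rewrite !mxE => /(congr1 (@complex.Im R)); rewrite Imsum.
  move=> e; transitivity (complex.Im (a * v 0 j)); last by case: (a) (v 0 j) => ? ? [].
  rewrite -e; apply: eq_bigr => i _; rewrite !mxE.
  by case: (v 0 i) => p q /=; rewrite mulr0 add0r.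
have xz0 : (x != 0) || (z != 0).
  rewrite -negb_and; apply: contra v0 => /andP[/eqP x0 /eqP z0].
  apply/eqP/rowP => i; move/rowP/(_ i) : x0; move/rowP/(_ i) : z0; rewrite !mxE.
  by case: (v 0 i) => /= p q -> ->.
have sw (u w : 'rV[R]_n.+1) : (u *m w^T) 0 0 = (w *m u^T) 0 0.
  by rewrite -{1}[u]trmxK -trmx_mul mxE.
have q0 : complex.Im a = 0.
  have h : (x *m A *m z^T) 0 0 = (z *m A *m x^T) 0 0.
    by rewrite sw trmx_mul sA mulmxA.
  have MB (u w : 'M[R]_1) : (u - w) 0 0 = u 0 0 - w 0 0 by rewrite !mxE.
  have MD (u w : 'M[R]_1) : (u + w) 0 0 = u 0 0 + w 0 0 by rewrite !mxE.
  have MZ b (u : 'M[R]_1) : (b *: u) 0 0 = b * u 0 0 by rewrite !mxE.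
  move: h; rewrite xA zA mulmxBl mulmxDl -!scalemxAl MB MD !MZ (sw x z) => h.
  have := row_sqnorm_ge0 x; have := row_sqnorm_ge0 z; move: h.
  set Sz := (z *m z^T) 0 0; set Sx := (x *m x^T) 0 0 => h Sz0 Sx0.
  have : complex.Im a * (Sz + Sx) = 0 by lra.
  move/eqP; rewrite mulf_eq0 => /orP[/eqP//|].
  case/orP: xz0 => /row_sqnorm_gt0; rewrite -?/Sx -?/Sz => gt0 /eqP; lra.
exists (complex.Re a); apply/eigenvalueP.
by case/orP: xz0 => u0; [exists x|exists z] => //; rewrite (xA, zA) q0 scale0r ?subr0 ?addr0.
Qed.

(* The Householder reflection exchanging v and the first basis vector. *)
Lemma orthogonal_with_first_row (R : realType) n (v : 'rV[R]_(1 + n)) :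
  v *m v^T = 1%:M ->
  exists H : 'M[R]_(1 + n), H *m H^T = 1%:M /\ delta_mx 0 0 *m H = v.
Proof.
move=> vv; pose e : 'rV[R]_(1 + n) := delta_mx 0 0.
have [->|ev] := eqVneq v e; first by exists 1%:M; rewrite trmx1 !mulmx1.
pose u := e - v; have u0 : u != 0 by rewrite subr_eq0 eq_sym.
have uu := row_sqnorm_gt0 u0; set s := (u *m u^T) 0 0 in uu.
have sE : u *m u^T = s%:M by rewrite [LHS]mx11_scalar.
have ee : e *m e^T = 1%:M.
  by rewrite trmx_delta mul_delta_mx; apply/matrixP => i j; rewrite !mxE !ord1.
have eu : e *m u^T = (s / 2)%:M.
  have esw : v *m e^T = e *m v^T.
    by rewrite [LHS]mx11_scalar [RHS]mx11_scalar -{1}[v]trmxK -trmx_mul mxE.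
  have : u *m u^T = 2 *: (e *m u^T).
    have -> : (e - v)^T = e^T - v^T by rewrite linearB.
    rewrite /u mulmxBl !mulmxBr vv ee esw scalerBr !scaler_nat !mulr2n.
    by rewrite opprB addrACA -opprD.
  rewrite sE [e *m u^T]mx11_scalar => /matrixP/(_ 0 0); rewrite !mxE eqxx !mulr1n => ->.
  by congr _%:M; field.
have uE : u = e - v by [].
clearbody s u.
exists (1%:M - (2 / s) *: (u^T *m u)); split.
  have -> : (1%:M - (2 / s) *: (u^T *m u))^T = 1%:M - (2 / s) *: (u^T *m u).
    by rewrite linearB linearZ /= trmx1 trmx_mul trmxK.
  rewrite mulmxBl mul1mx mulmxBr mulmx1 -scalemxAl -scalemxAr scalerA.
  rewrite mulmxA -(mulmxA u^T) sE mul_mx_scalar -scalemxAl scalerA.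
  rewrite -addrA -!opprD -[RHS]subr0; congr (_ - _).
  rewrite -scalerBl -scalerDl -[RHS](scale0r (u^T *m u)); congr (_ *: _).
  by field; rewrite gt_eqF.
rewrite mulmxBr mulmx1 -scalemxAr mulmxA eu mul_scalar_mx scalerA.
have -> : 2 / s * (s / 2) = 1 by field; rewrite gt_eqF.
by rewrite scale1r uE opprB addrC subrK.
Qed.

(** Deflation: an orthogonal matrix with a unit eigenvector as its first row turns the first row of
    A into a multiple of the first basis vector. Symmetry then clears the first column as well, and
    the lower right block is symmetric of smaller size. *)
Lemma symmetric_spectral (R : realType) n (A : 'M[R]_n) : A^T = A ->
  exists Q (D : 'rV[R]_n), Q *m Q^T = 1%:M /\ Q *m A *m Q^T = diag_mx D.
Proof.
elim: n A => [|n IH] A sA.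
  by exists 1%:M, 0; rewrite !thinmx0; split; apply/matrixP => -[].
have [a /eigenvalueP[v vA v0]] := symmetric_eigenvalue sA.
have vv := row_sqnorm_gt0 v0; set t := (v *m v^T) 0 0 in vv.
pose w := (Num.sqrt t)^-1 *: v.
have wA : w *m A = a *: w by rewrite /w -scalemxAl vA !scalerA mulrC.
have ww : w *m w^T = 1%:M.
  rewrite /w linearZ /= -scalemxAl -scalemxAr scalerA [v *m v^T]mx11_scalar -/t.
  rewrite scale_scalar_mx; congr _%:M; rewrite -invfM -expr2 sqr_sqrtr ?ltW//.
  by rewrite mulVf ?gt_eqF.
have [H [HH eH]] := orthogonal_with_first_row ww.
pose C : 'M[R]_(1 + n) := H *m A *m H^T.
have sC : C^T = C by rewrite /C !trmx_mul trmxK sA mulmxA.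
pose e : 'rV[R]_(1 + n) := delta_mx 0 0.
have eC : e *m C = a *: e.
  by rewrite /C !mulmxA eH wA -scalemxAl -eH -mulmxA HH mulmx1.
have C0 j : C 0 j = (a *: e) 0 j by rewrite -eC -rowE [RHS]mxE.
have CE : C = block_mx a%:M 0 0 (drsubmx C).
  have bE (P P' : 'M[R]_1) Q Q' S S' (V : 'M[R]_n) : P = P' -> Q = Q' -> S = S' ->
      block_mx P Q S V = block_mx P' Q' S' V by move=> -> -> ->.
  move: (C) sC C0 => C' sC' C0'.
  rewrite -[LHS]submxK; apply: bE; apply/matrixP => i j; rewrite !mxE.
  - rewrite !ord1 /= (_ : lshift n 0 = 0); last exact/val_inj.
    by rewrite C0' !mxE eqxx mulr1.
  - rewrite !ord1 (_ : lshift n 0 = 0); last exact/val_inj.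
    by rewrite C0' !mxE /= mulr0.
  - rewrite -sC' mxE !ord1 (_ : lshift n 0 = 0); last exact/val_inj.
    by rewrite C0' !mxE /= mulr0.
have sD : (drsubmx C)^T = drsubmx C.
  by rewrite -{2}sC trmx_drsub.
have [Q [D [QQ QD]]] := IH _ sD.
pose B : 'M[R]_(1 + n) := block_mx 1%:M 0 0 Q.
have BT : B^T = block_mx 1%:M 0 0 Q^T by rewrite /B tr_block_mx trmx1 !trmx0.
(* The goal is restated at dimension [1 + n], convertible to [n.+1], so that block matrices can be
   supplied as witnesses. *)
suff h : exists (Q' : 'M[R]_(1 + n)) (D' : 'rV[R]_(1 + n)),
  Q' *m Q'^T = 1%:M /\ Q' *m (A : 'M[R]_(1 + n)) *m Q'^T = diag_mx D' by exact: h.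
exists (B *m H), (row_mx a%:M D); split.
  rewrite trmx_mul mulmxA -(mulmxA B) HH mulmx1 BT /B mulmx_block.
  by rewrite !mulmx0 !mul0mx !addr0 !add0r mulmx1 QQ -scalar_mx_block.
rewrite trmx_mul !mulmxA -(mulmxA B H) -(mulmxA B (H *m A)) -/C CE BT /B !mulmx_block.
rewrite !mulmx0 !mul0mx !addr0 !add0r !mulmx1 !mul1mx QD diag_mx_row mul0mx.
have -> // : diag_mx (a%:M : 'M[R]_1) = a%:M.
by apply/matrixP => i j; rewrite !mxE !ord1 eqxx mulr1n.
Qed.

(** * Euclidean norms *)

Section euclidean.
Context (R : realType).

(** Cauchy-Schwarz: H f - S g is H times the component of f orthogonal to g, and its squared length
    is H (F H - S^2). The case H = 0 is separate because H has to be cancelled. *)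
Lemma sqr_sum_mul_le (I : finType) (f g : I -> R) :
  (\sum_i f i * g i) ^+ 2 <= (\sum_i f i ^+ 2) * (\sum_i g i ^+ 2).
Proof.
set S := \sum_i f i * g i; set F := \sum_i _ ^+ 2; set H := \sum_i _ ^+ 2.
have H0 : 0 <= H by apply: sumr_ge0 => i _; exact: sqr_ge0.
have [Hz|Hn0] := eqVneq H 0.
  have g0 i : g i = 0.
    have /eqP := Hz; rewrite psumr_eq0 => [/allP/(_ i (mem_index_enum _))|j _]; last exact: sqr_ge0.
    by rewrite sqrf_eq0 => /eqP.
  by rewrite Hz mulr0 /S big1 ?expr0n// => i _; rewrite g0 mulr0.
have Hp : 0 < H by rewrite lt_neqAle eq_sym Hn0.
have : 0 <= \sum_i (f i * H - g i * S) ^+ 2 by apply: sumr_ge0 => i _; exact: sqr_ge0.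
have -> : \sum_i (f i * H - g i * S) ^+ 2 = H * (F * H - S ^+ 2).
  transitivity (\sum_i (f i ^+ 2 * H ^+ 2 + (f i * g i * (- 2 * H * S) + g i ^+ 2 * S ^+ 2))).
    by apply: eq_bigr => i _; ring.
  rewrite !big_split /= -!mulr_suml -/F -/S -/H; ring.
by rewrite pmulr_rge0// subr_ge0.
Qed.

(** Cauchy-Schwarz against the indicator of A. This is where the sparsity s enters the estimates on
    the support. *)
Lemma sqr_sum_le_card (I : finType) (A : {pred I}) (f : I -> R) :
  (\sum_(i in A) f i) ^+ 2 <= #|A|%:R * \sum_(i in A) f i ^+ 2.
Proof.
pose g i := if i \in A then f i else 0.
have -> : #|A|%:R = \sum_i (i \in A)%:R ^+ 2 :> R.
  rewrite -sum1_card natr_sum big_mkcond; apply: eq_bigr => i _.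
  by case: (i \in A); rewrite ?expr1n ?expr0n.
have -> : \sum_(i in A) f i = \sum_i (i \in A)%:R * g i.
  rewrite big_mkcond; apply: eq_bigr => i _.
  by rewrite /g; case: (i \in A); rewrite ?mul1r ?mul0r.
have -> : \sum_(i in A) f i ^+ 2 = \sum_i g i ^+ 2.
  rewrite big_mkcond; apply: eq_bigr => i _.
  by rewrite /g; case: (i \in A); rewrite ?expr0n.
exact: sqr_sum_mul_le.
Qed.

Definition dotv n (u v : 'cV[R]_n) : R := \sum_i u i 0 * v i 0.

Lemma dotvC n (u v : 'cV[R]_n) : dotv u v = dotv v u.
Proof. by apply: eq_bigr => i _; rewrite mulrC. Qed.

Lemma dotvDl n (u v w : 'cV[R]_n) : dotv (u + v) w = dotv u w + dotv v w.
Proof. by rewrite -big_split; apply: eq_bigr => i _; rewrite mxE mulrDl. Qed.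

Lemma dotvZl n a (u v : 'cV[R]_n) : dotv (a *: u) v = a * dotv u v.
Proof. by rewrite mulr_sumr; apply: eq_bigr => i _; rewrite mxE mulrA. Qed.

Lemma dotvNl n (u v : 'cV[R]_n) : dotv (- u) v = - dotv u v.
Proof. by rewrite -scaleN1r dotvZl mulN1r. Qed.

Lemma dotv0l n (v : 'cV[R]_n) : dotv 0 v = 0.
Proof. by rewrite -(scale0r (0 : 'cV[R]_n)) dotvZl mul0r. Qed.

Lemma dotvDr n (u v w : 'cV[R]_n) : dotv w (u + v) = dotv w u + dotv w v.
Proof. by rewrite dotvC dotvDl !(dotvC w). Qed.

Lemma dotvZr n a (u v : 'cV[R]_n) : dotv v (a *: u) = a * dotv v u.
Proof. by rewrite dotvC dotvZl dotvC. Qed.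

Lemma dotvNr n (u v : 'cV[R]_n) : dotv v (- u) = - dotv v u.
Proof. by rewrite dotvC dotvNl dotvC. Qed.

Lemma dotv_suml (I : finType) (Q : pred I) n (u : I -> 'cV[R]_n) v :
  dotv (\sum_(i | Q i) u i) v = \sum_(i | Q i) dotv (u i) v.
Proof.
by apply: (big_morph (fun u => dotv u v) (fun u w => dotvDl u w v) (dotv0l v)).
Qed.

Lemma dotv_sumr (I : finType) (Q : pred I) n (u : I -> 'cV[R]_n) v :
  dotv v (\sum_(i | Q i) u i) = \sum_(i | Q i) dotv v (u i).
Proof. by rewrite dotvC dotv_suml; apply: eq_bigr => i _; rewrite dotvC. Qed.

Lemma dotv_mulmx m n (A : 'M[R]_(m, n)) u v :
  dotv (A *m u) v = dotv u (A^T *m v).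
Proof.
rewrite /dotv; under eq_bigr do rewrite mxE mulr_suml.
rewrite exchange_big; apply: eq_bigr => j _ /=.
by rewrite mxE mulr_sumr; apply: eq_bigr => i _; rewrite mxE mulrCA mulrA.
Qed.

Lemma enorm_ge0 n (v : 'cV[R]_n) : 0 <= enorm v.
Proof. exact: sqrtr_ge0. Qed.

Lemma sqr_enorm n (v : 'cV[R]_n) : enorm v ^+ 2 = dotv v v.
Proof.
rewrite sqr_sqrtr; first by apply: eq_bigr => i _; rewrite expr2.
by apply: sumr_ge0 => i _; exact: sqr_ge0.
Qed.

Lemma dotv_le n (u v : 'cV[R]_n) : `|dotv u v| <= enorm u * enorm v.
Proof.
rewrite -(@ler_pXn2r _ 2) ?nnegrE ?mulr_ge0 ?enorm_ge0//.
rewrite real_normK ?num_real// exprMn !sqr_sqrtr ?sqr_sum_mul_le//;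
by apply: sumr_ge0 => i _; exact: sqr_ge0.
Qed.

Lemma sqr_enormD n (u v : 'cV[R]_n) :
  enorm (u + v) ^+ 2 = enorm u ^+ 2 + 2 * dotv u v + enorm v ^+ 2.
Proof. by rewrite !sqr_enorm dotvDl !dotvDr (dotvC v u); ring. Qed.

Lemma enormD n (u v : 'cV[R]_n) : enorm (u + v) <= enorm u + enorm v.
Proof.
rewrite -(@ler_pXn2r _ 2) ?nnegrE ?addr_ge0 ?enorm_ge0//.
rewrite sqr_enormD sqrrD.
have := le_trans (ler_norm _) (dotv_le u v); lra.
Qed.

Lemma enormZ n a (u : 'cV[R]_n) : enorm (a *: u) = `|a| * enorm u.
Proof.
rewrite /enorm -sqrtr_sqr -sqrtrM ?sqr_ge0// mulr_sumr; congr Num.sqrt.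
by apply: eq_bigr => i _; rewrite mxE exprMn.
Qed.

Lemma enormN n (u : 'cV[R]_n) : enorm (- u) = enorm u.
Proof. by rewrite -scaleN1r enormZ normrN1 mul1r. Qed.

Lemma enorm0 n : enorm (0 : 'cV[R]_n) = 0.
Proof. by rewrite -(scale0r (0 : 'cV[R]_n)) enormZ normr0 mul0r. Qed.

(** The constant is the Frobenius norm, but only its existence matters: it bounds the set whose
    [sup] defines [spectral_norm], so that this [sup] dominates its elements. *)
Lemma enorm_mulmx_le m n (A : 'M[R]_(m, n)) :
  exists C, forall v, enorm (A *m v) <= C * enorm v.
Proof.
exists (Num.sqrt (\sum_i \sum_j A i j ^+ 2)) => v.
have S0 (I : finType) (f : I -> R) : 0 <= \sum_i f i ^+ 2.
  by apply: sumr_ge0 => i _; exact: sqr_ge0.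
rewrite /enorm -sqrtrM; last by apply: sumr_ge0.
rewrite ler_wsqrtr// mulr_suml; apply: ler_sum => i _.
by rewrite mxE sqr_sum_mul_le.
Qed.

Lemma enorm_le_spectral_norm n (A : 'M[R]_n) v :
  enorm v <= 1 -> enorm (A *m v) <= spectral_norm A.
Proof.
move=> v1; apply: ub_le_sup; last by exists v.
have [C AC] := enorm_mulmx_le A.
exists (`|C|) => _ [w w1 <-].
apply: le_trans (AC w) _; apply: le_trans (_ : `|C| * enorm w <= _).
  by rewrite ler_wpM2r ?enorm_ge0 ?ler_norm.
by rewrite ler_piMr.
Qed.

End euclidean.

(** * Moments and tails of Gaussian vectors *)

Section comp_density.
Local Open Scope classical_set_scope.
Local Open Scope ereal_scope.
Import HBNNSimple.

(** The hypothesis on sets B is the case where f is an indicator; linearity extends it to simple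
    functions and monotone convergence to all nonnegative f. It serves twice: with h constant and g
    the product of the other factors, to exploit independence, and with g = 1 and h the normal
    density, to compute expectations from the law. *)
Lemma ge0_integral_comp_density d1 d2 (T1 : measurableType d1)
    (T2 : measurableType d2) (R : realType) (m1 : {measure set T1 -> \bar R})
    (m2 : {measure set T2 -> \bar R}) (V : T1 -> T2) (g : T1 -> R)
    (h f : T2 -> R) :
  measurable_fun [set: T1] V -> measurable_fun [set: T1] g ->
  measurable_fun [set: T2] h -> measurable_fun [set: T2] f ->
  (forall x, 0 <= g x)%R -> (forall x, 0 <= h x)%R -> (forall x, 0 <= f x)%R ->
  (forall B, measurable B ->
     \int[m1]_(x in V @^-1` B) (g x)%:E = \int[m2]_(x in B) (h x)%:E) ->
  \int[m1]_x (f (V x) * g x)%:E = \int[m2]_x (f x * h x)%:E.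
Proof.
move=> mV mg mh mf g0 h0 f0 gh.
have mEf : measurable_fun [set: T2] (EFin \o f) by exact/measurable_EFinP.
pose a := nnsfun_approx measurableT mEf.
have a0 n x : (0 <= a n x)%R by rewrite fun_ge0.
have ma n : measurable_fun setT (a n) by [].
have mVa n : measurable_fun setT (a n \o V) by exact: measurableT_comp.
have acvg x : (a n x)%:E @[n --> \oo] --> (f x)%:E.
  by apply: (cvg_nnsfun_approx measurableT mEf) => // y _; rewrite lee_fin.
have a_nd x n m : (n <= m)%N -> (a n x <= a m x)%R.
  by move=> nm; exact/lefP/nd_nnsfun_approx.
(* [lim] and, below, [simple] are stated for an arbitrary map U: the left side is the case [U = V]
   and the right side the case of the identity. *)
have lim d (T : measurableType d) (m : {measure set T -> \bar R}) (U : T -> T2)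
    (k : T -> R) : measurable_fun [set: T] U -> measurable_fun [set: T] k ->
    (forall x, 0 <= k x)%R ->
    \int[m]_x (f (U x) * k x)%:E = limn (fun n => \int[m]_x (a n (U x) * k x)%:E).
  move=> mU mk k0; rewrite -monotone_convergence//.
  - apply: eq_integral => x _; apply/esym/cvg_lim => //.
    under eq_fun do rewrite EFinM.
    by rewrite EFinM; apply: cvgeZr => //; exact: acvg.
  - move=> n; apply/measurable_EFinP/measurable_funM => //.
    exact: (measurableT_comp (ma n)).
  - by move=> n x _; rewrite lee_fin mulr_ge0.
  - by move=> x _ n p np; rewrite lee_fin ler_wpM2r// a_nd.
rewrite (lim _ _ m1 V)// (lim _ _ m2 id)//; congr (limn _); apply/funext => n.
have simple d (T : measurableType d) (m : {measure set T -> \bar R}) (U : T -> T2)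
    (k : T -> R) : measurable_fun [set: T] U -> measurable_fun [set: T] k ->
    (forall x, 0 <= k x)%R ->
    \int[m]_x (a n (U x) * k x)%:E =
    \sum_(r \in range (a n)) r%:E * \int[m]_(x in U @^-1` (a n @^-1` [set r])) (k x)%:E.
  move=> mU mk k0.
  have mP r : measurable (U @^-1` (a n @^-1` [set r])).
    by rewrite -[X in measurable X]setTI; apply: mU.
  transitivity (\int[m]_x (\sum_(r \in range (a n))
      (r * \1_(a n @^-1` [set r]) (U x) * k x)%:E)).
    apply: eq_integral => x _; rewrite fsumEFin//; congr EFin.
    by rewrite fimfunE mulr_fsuml.
  rewrite ge0_integral_fsum//.
  - apply: eq_fsbigr => r; rewrite inE => -[y _ yr].
    have r0 : (0 <= r)%R by rewrite -yr.
    rewrite [in RHS]integral_mkcond -ge0_integralZl_EFin//.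
    + apply: eq_integral => x _; rewrite patchE indicE -mulrA EFinM; congr (_ * _).
      have -> : (U x \in a n @^-1` [set r]) = (x \in U @^-1` (a n @^-1` [set r])).
        by apply/idP/idP; rewrite !inE.
      by case: ifPn => _; rewrite ?mul1r ?mul0r.
    + by move=> x _; rewrite patchE; case: ifPn; rewrite ?lee_fin.
    + apply/(measurable_restrictT _ (mP r))/measurable_funTS.
      exact/measurable_EFinP.
  - move=> r; apply/measurable_EFinP/measurable_funM => //.
    apply: measurable_funM => //; apply: measurableT_comp => //.
  - move=> r x _; rewrite lee_fin mulr_ge0// .
    by have := nnfun_muleindic_ge0 (a n) r (U x); rewrite -EFinM lee_fin.
by rewrite (simple _ _ m1 V)// (simple _ _ m2 id)//; apply: eq_fsbigr => r _; rewrite gh.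
Qed.

End comp_density.

Section independent_product.
Local Open Scope classical_set_scope.
Local Open Scope ereal_scope.
Context d (T : measurableType d) (R : realType) (P : probability T R).

(** For indicator factors this is the product rule. The factors are then freed one at a time: I
    collects the indices at which [f i] may differ from an indicator, and the induction is on its
    cardinality. *)
Lemma ge0_expectation_prod_independent n (W : 'I_n -> {RV P >-> R})
    (f : 'I_n -> R -> R) (e : 'I_n -> R) :
  mutually_independent W ->
  (forall i, measurable_fun [set: R] (f i)) -> (forall i x, 0 <= f i x)%R ->
  (forall i, \int[P]_w (f i (W i w))%:E = (e i)%:E) ->
  \int[P]_w (\prod_i f i (W i w))%:E = (\prod_i e i)%:E.
Proof.
move=> indW.
suff H m (I : {set 'I_n}) : #|I| = m -> forall (f : 'I_n -> R -> R) (e : 'I_n -> R),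
    (forall i, i \notin I -> exists2 B, measurable B & f i = \1_B) ->
    (forall i, measurable_fun [set: R] (f i)) -> (forall i x, 0 <= f i x)%R ->
    (forall i, \int[P]_w (f i (W i w))%:E = (e i)%:E) ->
    \int[P]_w (\prod_i f i (W i w))%:E = (\prod_i e i)%:E.
  by apply: (H _ [set: 'I_n]%SET erefl) => i; rewrite inE.
elim: m I => [|m IH] I cI {}f {}e fI mf f0 ef.
  have I0 : I = finset.set0 by apply: cards0_eq.
  have /choice[B BE] : forall i, exists B, measurable B /\ f i = \1_B.
    by move=> i; have [|B mB fB] := fI i; [rewrite I0 inE|exists B].
  have mWB i : measurable (W i @^-1` B i).
    by rewrite -[X in measurable X]setTI; apply: measurable_funP => //; case: (BE i).
  have eE i : (e i)%:E = P (W i @^-1` B i).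
    by rewrite -ef (BE i).2 -[in RHS](setIT (W i @^-1` B i)) -integral_indic.
  have := indW [set: 'I_n]%SET B (fun i => (BE i).1).
  under [in RHS]eq_bigr do rewrite -eE.
  rewrite prodEFin [in RHS](eq_bigl xpredT) => [<-|i]; last by rewrite inE.
  rewrite -[X in _ = P X]setIT -integral_indic//; last first.
    by apply: fin_bigcap_measurable => // i _; exact: mWB.
  apply: eq_integral => w _; congr EFin; rewrite indicE.
  have [wB|wB] := boolP (w \in _).
    rewrite big1// => i _; rewrite (BE i).2 indicE mem_set//.
    by move: wB; rewrite inE => /(_ i); apply; rewrite /= inE.
  have [i nB] : exists i, ~ B i (W i w).
    apply/existsNP => h; move/negP: wB; apply; rewrite inE => i _; exact: h.
  rewrite (bigD1 i)//= (BE i).2 indicE memNset// mul0r//.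
have /card_gt0P[i0 i0I] : (0 < #|I|)%N by rewrite cI.
pose C := (\prod_(i | i != i0) e i)%R.
have e0 i : (0 <= e i)%R.
  by rewrite -lee_fin -ef; apply: integral_ge0 => w _; rewrite lee_fin.
pose g w := (\prod_(i | i != i0) f i (W i w))%R.
have mfW i : measurable_fun [set: T] (fun w => f i (W i w)).
  exact: (measurableT_comp (mf i)).
have mg : measurable_fun [set: T] g.
  by rewrite /g; under eq_fun do rewrite big_mkcond; apply: measurable_prod => i _; case: (i != i0).
transitivity (\int[P]_w (f i0 (W i0 w) * g w)%:E).
  by apply: eq_integral => w _; rewrite (bigD1 i0).
rewrite (@ge0_integral_comp_density _ _ _ _ _ P (distribution P (W i0)) (W i0) g (cst C))//.
- under eq_integral do rewrite mulrC EFinM.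
  rewrite ge0_integralZl_EFin//; last 3 first.
  + by move=> x _; rewrite lee_fin.
  + exact/measurable_EFinP.
  + by apply: prodr_ge0.
  rewrite ge0_integral_pushforward//; last 2 first.
  + exact/measurable_EFinP.
  + by move=> x _; rewrite lee_fin.
  by rewrite preimage_setT ef -EFinM mulrC; congr EFin; rewrite [RHS](bigD1 i0).
- by move=> w; apply: prodr_ge0.
- by move=> w; apply: prodr_ge0.
move=> B mB.
transitivity (C%:E * distribution P (W i0) B); last first.
  by rewrite -(integral_cst (distribution P (W i0)) mB).
rewrite integral_mkcond.
(* With an indicator at [i0] the induction hypothesis applies to I without [i0]. It says that the
   remaining product, integrated over the event that [W i0] lies in B, is C times the law of [W i0]
   at B, which is the density condition to be checked. *)
pose f' i := if i == i0 then \1_B else f i.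
have mWB : measurable (W i0 @^-1` B).
  by rewrite -[X in measurable X]setTI; apply: measurable_funP.
pose e' i := if i == i0 then fine (P (W i0 @^-1` B)) else e i.
have := IH (I :\ i0)%SET _ f' e'.
have -> : (\prod_i e' i)%:E = C%:E * distribution P (W i0) B.
  rewrite (bigD1 i0)//= /e' eqxx mulrC EFinM fineK ?fin_num_measure//.
  by congr (_ %:E * _); apply: eq_bigr => i /negbTE ->.
move=> <-.
- apply: eq_integral => w _; rewrite (bigD1 i0)//= /f' eqxx patchE indicE.
  have -> : (W i0 w \in B) = (w \in W i0 @^-1` B) by apply/idP/idP; rewrite !inE.
  case: ifPn => _; rewrite ?mul0r// mul1r; congr EFin.
  by apply: eq_bigr => i /negbTE ->.
- by apply/eqP; rewrite -eqSS -cI (cardsD1 i0 I) i0I.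
- move=> i; rewrite in_setD1 negb_and negbK /f'; case: eqP => [_ _|_ /=]; last exact: fI.
  by exists B.
- by move=> i; rewrite /f'; case: ifP => // _; exact: measurable_indic.
- by move=> i x; rewrite /f'; case: ifP => // _; rewrite indicE.
- move=> i; rewrite /f' /e'; case: eqP => // ->.
  by rewrite fineK ?fin_num_measure// -[in RHS](setIT (_ @^-1` _)) -integral_indic.
Qed.
End independent_product.

(** * One-dimensional Gaussian integrals *)

Section gaussian_integrals.
Local Open Scope classical_set_scope.
Local Open Scope ereal_scope.
Context (R : realType).
Local Notation mu := (@lebesgue_measure R).

(** Completing the square: the factor exp (c x) moves the centre of the density to s^2 c and leaves
    a constant in front. *)
Lemma normal_exp_moment (s c : R) : s != 0%R ->
  \int[mu]_x (expR (c * x) * normal_pdf 0 s x)%:E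
    = (expR (s ^+ 2 * c ^+ 2 / 2))%:E.
Proof.
move=> s0.
transitivity (\int[mu]_x ((expR (s ^+ 2 * c ^+ 2 / 2))%:E *
    (normal_pdf (s ^+ 2 * c) s x)%:E)).
  apply: eq_integral => x _; rewrite -EFinM; congr EFin.
  rewrite !normal_pdfE// mulrCA [RHS]mulrCA; congr (_ * _)%R.
  rewrite -!expRD; congr expR.
  by rewrite !mulr2n; field; rewrite -mulr2n mulrn_eq0 sqrf_eq0.
rewrite ge0_integralZl_EFin ?expR_ge0//.
- by rewrite integral_normal_pdf; exact: mule1.
- by move=> x _; rewrite lee_fin; exact: normal_pdf_ge0.
- by apply/measurable_EFinP; exact: measurable_normal_pdf.
Qed.

(** The factor exp (u x^2 / 2) changes the variance from 1 to 1 / (1 - u); the value is the ratio of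
    the peaks of the two densities. *)
Lemma normal_exp_square_moment (u : R) : (u < 1)%R ->
  \int[mu]_x (expR (x ^+ 2 * u / 2) * normal_pdf 0 1 x)%:E
    = (Num.sqrt (1 - u))^-1%:E.
Proof.
move=> u1; have v0 : (0 < 1 - u)%R by rewrite subr_gt0.
set v := Num.sqrt (1 - u).
have v0' : (0 < v)%R by rewrite sqrtr_gt0.
have vv : (v ^+ 2 = 1 - u)%R by rewrite sqr_sqrtr ?ltW.
transitivity (\int[mu]_x ((v^-1)%:E * (normal_pdf 0 v^-1 x)%:E)).
  apply: eq_integral => x _; rewrite -EFinM; congr EFin.
  rewrite !normal_pdfE ?oner_eq0 ?invr_eq0 ?gt_eqF// mulrCA [RHS]mulrA; congr (_ * _)%R.
    rewrite /normal_peak -!mulrnAr (sqrtrM _ (sqr_ge0 _)) (sqrtrM _ (sqr_ge0 v^-1)).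
    rewrite !sqrtr_sqr normr1 mul1r ger0_norm ?invr_ge0 ?ltW//.
    by rewrite invfM invrK mulrA mulVf ?mul1r ?gt_eqF.
  rewrite -!expRD; congr expR.
  rewrite exprVn vv !mulr2n; field.
  by rewrite gt_eqF.
rewrite ge0_integralZl_EFin ?invr_ge0 ?(ltW v0')//.
- by rewrite integral_normal_pdf; exact: mule1.
- by move=> x _; rewrite lee_fin; exact: normal_pdf_ge0.
- by apply/measurable_EFinP; exact: measurable_normal_pdf.
Qed.

End gaussian_integrals.

Section gaussian_vector.
Local Open Scope classical_set_scope.
Local Open Scope ereal_scope.
Context d (T : measurableType d) (R : realType) (P : probability T R).
Context n (W : 'I_n -> {RV P >-> R}) (s : R).
Hypothesis iidW : iid_centered_normal W s.
Hypothesis s0 : s != 0%R.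

Lemma gaussian_vector_mgf (c : 'I_n -> R) :
  \int[P]_w (expR (\sum_i c i * W i w))%:E
    = (expR (s ^+ 2 * (\sum_i c i ^+ 2) / 2))%:E.
Proof.
have [ind law] := iidW.
transitivity (\int[P]_w (\prod_i expR (c i * W i w))%:E).
  by apply: eq_integral => w _; rewrite expR_sum.
rewrite (ge0_expectation_prod_independent (f := fun i x => expR (c i * x))
  (e := fun i => expR (s ^+ 2 * c i ^+ 2 / 2))) //.
- by rewrite -expR_sum mulr_sumr mulr_suml.
- by move=> i; apply: measurableT_comp => //; exact: measurable_funM.
move=> i; rewrite -normal_exp_moment//.
transitivity (\int[P]_w (expR (c i * W i w) * cst 1%R w)%:E).
  by apply: eq_integral => w _; rewrite mulr1.
rewrite (@ge0_integral_comp_density _ _ _ _ _ P lebesgue_measure (W i) (cst 1%R)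
  (normal_pdf 0 s) (fun x => expR (c i * x)))//.
- exact: measurable_funPT (W i).
- exact: measurable_normal_pdf.
- by apply: measurableT_comp => //; exact: measurable_funM.
- exact: normal_pdf_ge0.
(* [normal_prob] unfolds to the integral of [normal_pdf], so the law of [W i] is the density
   condition itself. *)
move=> B mB; rewrite -[RHS](law i B mB).
by rewrite (@integral_cst _ _ _ P _ _ 1%:E) ?mul1e// -[X in measurable X]setTI; apply: measurable_funP.
Qed.

Let sum_sqr_orthogonal k (B : 'M[R]_(n, k)) (z : 'I_k -> R) :
  (forall l l', l != l' -> \sum_i B i l * B i l' = 0)%R ->
  (\sum_i (\sum_l z l * B i l) ^+ 2 = \sum_l z l ^+ 2 * \sum_i B i l ^+ 2)%R.
Proof.
move=> orthB.
under eq_bigr do rewrite expr2 big_distrlr /=.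
rewrite exchange_big; apply: eq_bigr => l _ /=.
rewrite exchange_big (bigD1 l)//= [X in (_ + X)%R]big1 ?addr0.
  by rewrite mulr_sumr; apply: eq_bigr => i _; ring.
move=> l' l'l; transitivity (z l * z l' * \sum_i B i l * B i l')%R.
  by rewrite mulr_sumr; apply: eq_bigr => i _; ring.
by rewrite orthB ?mulr0// eq_sym.
Qed.

(* Hubbard-Stratonovich: exp (S ^+ 2 / 2) is the normal average of exp (z S),
   which turns the squares into linear forms one at a time; orthogonality keeps
   the Gaussian exponents separated. *)
Lemma gaussian_vector_square_mgf k (B : 'M[R]_(n, k)) :
  (forall l l', l != l' -> \sum_i B i l * B i l' = 0)%R ->
  (forall l, s ^+ 2 * (\sum_i B i l ^+ 2) < 1)%R ->
  \int[P]_w (expR ((\sum_l (\sum_i B i l * W i w) ^+ 2) / 2))%:E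
   = (\prod_l (Num.sqrt (1 - s ^+ 2 * \sum_i B i l ^+ 2))^-1)%:E.
Proof.
move=> orthB; set u := fun l => (s ^+ 2 * \sum_i B i l ^+ 2)%R => u1.
pose S l w := (\sum_i B i l * W i w)%R.
have mS l : measurable_fun [set: T] (S l).
  by apply: measurable_sum => i; apply: measurable_funM.
(* L indexes the squares still present; outside L they have been replaced by linear terms with
   coefficients z. The claim is the case of full L, and at empty L only a linear form is left. *)
suff H m (L : {set 'I_k}) (z : 'I_k -> R) : #|L| = m ->
    \int[P]_w (expR (\sum_(l in ~: L) z l * S l w + \sum_(l in L) S l w ^+ 2 / 2))%:E
    = (expR (\sum_(l in ~: L) z l ^+ 2 * u l / 2)
       * \prod_(l in L) (Num.sqrt (1 - u l))^-1)%:E.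
  have := H _ [set: 'I_k]%SET (fun=> 0%R) erefl.
  rewrite finset.setCT !big_set0 expR0 mul1r (eq_bigl xpredT); last by move=> i; rewrite inE.
  move=> <-; apply: eq_integral => w _.
  rewrite big_set0 add0r mulr_suml; congr (expR _)%:E.
  by apply: eq_bigl => i; rewrite inE.
elim: m L z => [|m IH] L z cL.
  have -> : L = finset.set0 by apply: cards0_eq.
  rewrite finset.setC0 big_set0 mulr1.
  have inT F : (\sum_(l in [set: 'I_k]%SET) F l = \sum_l F l :> R)%R.
    by apply: eq_bigl => l; rewrite inE.
  rewrite inT; under [in RHS]eq_bigr do rewrite /u mulrCA.
  rewrite -mulr_suml -mulr_sumr -(sum_sqr_orthogonal z orthB) -gaussian_vector_mgf.
  apply: eq_integral => w _; rewrite big_set0 addr0 inT; congr (expR _)%:E.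
  under eq_bigr do rewrite mulr_sumr.
  rewrite exchange_big; apply: eq_bigr => i _ /=.
  by rewrite mulr_suml; apply: eq_bigr => l _; rewrite mulrA.
have /card_gt0P[l0 l0L] : (0 < #|L|)%N by rewrite cL.
pose L' := (L :\ l0)%SET.
have cL' : #|L'| = m by apply/eqP; rewrite -eqSS -cL (cardsD1 l0 L) l0L.
pose A w := (\sum_(l in ~: L) z l * S l w + \sum_(l in L') S l w ^+ 2 / 2)%R.
have mA : measurable_fun [set: T] A.
  apply: measurable_funD; under eq_fun do rewrite big_mkcond /=.
    apply: measurable_sum => l; case: (l \in _) => //.
    exact: measurable_funM.
  apply: measurable_sum => l; case: (l \in _) => //.
  by apply: measurable_funM => //; exact: measurable_funX.
transitivity (\int[P]_w \int[lebesgue_measure]_x (expR (A w + x * S l0 w) * normal_pdf 0 1 x)%:E).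
  apply: eq_integral => w _.
  rewrite (big_setD1 l0 l0L)/= addrCA -/L' -/(A w) expRD mulrC EFinM.
  have := normal_exp_moment (S l0 w) (oner_neq0 R).
  rewrite expr1n mul1r => <-.
  rewrite -ge0_integralZl_EFin ?expR_ge0//; last 2 first.
  - by move=> x _; rewrite lee_fin mulr_ge0 ?expR_ge0 ?normal_pdf_ge0.
  - apply/measurable_EFinP; apply: measurable_funM => //.
      by apply: measurableT_comp => //; exact: measurable_funM.
    exact: measurable_normal_pdf.
  apply: eq_integral => x _; rewrite -EFinM; congr EFin.
  by rewrite [in RHS]expRD mulrA (mulrC x).
(* By Tonelli the noise is integrated first: for fixed x the induction hypothesis applies with
   coefficient x at [l0], and what remains is the normal integral of exp (x^2 u / 2) with u =
   [u l0]. *)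
transitivity (\int[lebesgue_measure]_x \int[P]_w
    (expR (A w + x * S l0 w) * normal_pdf 0 1 x)%:E).
  apply: (fubini_tonelli (m2 := lebesgue_measure) (fun wx : T * R =>
    (expR (A wx.1 + wx.2 * S l0 wx.1) * normal_pdf 0 1 wx.2)%:E)) => [|wx].
    apply/measurable_EFinP; apply: measurable_funM; last first.
      by apply: (measurableT_comp (measurable_normal_pdf 0 1)) => //; exact: measurable_snd.
    apply: measurableT_comp => //; apply: measurable_funD.
      by apply: (measurableT_comp mA); exact: measurable_fst.
    apply: measurable_funM; first exact: measurable_snd.
    by apply: (measurableT_comp (mS l0)); exact: measurable_fst.
  by rewrite lee_fin mulr_ge0 ?expR_ge0 ?normal_pdf_ge0.
pose z' x l := if l == l0 then x else z l.
have l0L' : l0 \in ~: L' by rewrite !inE eqxx.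
have L'L : ((~: L') :\ l0)%SET = ~: L.
  by apply/setP => l; rewrite !inE negb_and negbK; case: eqVneq => //= ->; rewrite l0L.
have z'E x (F : 'I_k -> R -> R) :
    (\sum_(l in ~: L) F l (z' x l) = \sum_(l in ~: L) F l (z l))%R.
  apply: eq_bigr => l; rewrite inE /z'; case: eqVneq => // ->.
  by rewrite l0L.
have E x : \int[P]_w (expR (A w + x * S l0 w) * normal_pdf 0 1 x)%:E =
   (expR (\sum_(l in ~: L) z l ^+ 2 * u l / 2)
       * \prod_(l in L') (Num.sqrt (1 - u l))^-1)%:E *
   (expR (x ^+ 2 * u l0 / 2) * normal_pdf 0 1 x)%:E.
  under eq_integral do rewrite EFinM.
  rewrite ge0_integralZr//; last 2 first.
  - apply/measurable_EFinP; apply: measurableT_comp => //.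
    by apply: measurable_funD => //; exact: measurable_funM.
  - by rewrite lee_fin normal_pdf_ge0.
  rewrite [X in _ = _ * X]EFinM muleA; congr (_ * _).
  transitivity (\int[P]_w (expR (\sum_(l in ~: L') z' x l * S l w +
      \sum_(l in L') S l w ^+ 2 / 2))%:E).
    apply: eq_integral => w _; congr (expR _)%:E.
    rewrite (big_setD1 l0 l0L')/= L'L (z'E x (fun l y => y * S l w)%R) /z' eqxx.
    by rewrite [RHS]addrAC addrC addrAC addrA.
  rewrite (IH _ _ cL') (big_setD1 l0 l0L')/= L'L (z'E x (fun l y => y ^+ 2 * u l / 2)%R).
  rewrite /z' eqxx expRD -EFinM; congr EFin; ring.
under eq_integral do rewrite E.
rewrite ge0_integralZl_EFin//; last 3 first.
- by move=> x _; rewrite lee_fin mulr_ge0 ?expR_ge0 ?normal_pdf_ge0.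
- apply/measurable_EFinP; apply: measurable_funM => //.
    apply: measurableT_comp => //; apply: measurable_funM => //.
    by apply: measurable_funM => //; exact: measurable_funX.
  exact: measurable_normal_pdf.
- rewrite mulr_ge0 ?expR_ge0//; apply: prodr_ge0 => l _.
  by rewrite invr_ge0 sqrtr_ge0.
rewrite (normal_exp_square_moment (u1 l0)) -EFinM -mulrA; congr (_ * _)%:E.
by rewrite [RHS](big_setD1 l0)//= mulrC.
Qed.

End gaussian_vector.

(** * Elementary inequalities for the Chernoff exponent *)

Section real_inequalities.
Import numFieldNormedType.Exports.

(** The difference of the two sides vanishes at 0, and its derivative is nonnegative by adding the
    bound exp x >= 1 + x at x and at - x. *)
Lemma sinh_ge (R : realType) (t : R) : 0 <= t -> 2 * t <= expR t - expR (- t).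
Proof.
move=> t0; pose f (x : R) : R := expR x - expR (- x) - 2 * x.
have df (x : R) : is_derive x 1 f (expR x + expR (- x) - 2).
  rewrite /f; apply: is_derive_eq.
  by rewrite !scaler_nat; ring.
suff : f 0 <= f t by rewrite /f oppr0 expR0 mulr0 !subr0 subrr subr_ge0.
apply: (@ger0_derive1_ndecry _ f 0) => //.
- move=> x _; rewrite derive1E derive_val.
  have := expR_ge1Dx x; have := expR_ge1Dx (- x); lra.
- apply: continuous_subspaceT => x; apply: differentiable_continuous.
  by apply/derivable1_diffP; case: (df x).
Qed.

(** In logarithms this bounds t = - ln (1 - u) by u + u^2 / (2 (1 - u)), which equals ((1 - u)^-1 -
    (1 - u)) / 2, that is, half of exp t - exp (- t). *)
Lemma inv_sqrt_le_expR (R : realType) (u : R) : 0 <= u < 1 ->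
  (Num.sqrt (1 - u))^-1 <= expR ((u + u ^+ 2 / (2 * (1 - u))) / 2).
Proof.
move=> /andP[u0 u1]; have v0 : 0 < 1 - u by rewrite subr_gt0.
pose t := - ln (1 - u).
have tE : expR (- t) = 1 - u by rewrite opprK lnK.
have t0 : 0 <= t by rewrite oppr_ge0 ln_le0// lerBlDr lerDl.
have -> : (Num.sqrt (1 - u))^-1 = expR (t / 2).
  rewrite -tE (_ : - t = - (t / 2) + - (t / 2)); last by field.
  rewrite expRD -expr2 sqrtr_sqr ger0_norm ?expR_ge0//.
  by rewrite expRN invrK.
rewrite ler_expR ler_pM2r ?invr_gt0//.
have := sinh_ge t0; rewrite tE -[X in expR X]opprK expRN tE.
have -> : u + u ^+ 2 / (2 * (1 - u)) = ((1 - u)^-1 - (1 - u)) / 2.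
  by field; rewrite gt_eqF.
by move=> h; rewrite ler_pdivlMr// mulrC.
Qed.

(** With a and b the square roots of k and x, 1 - rho = a / (a + 2 b), the gain is 2 b^2 and the
    loss is a b^2 / (a + 2 b); the gain minus the loss exceeds x = b^2 by 2 b^3 / (a + 2 b). The
    condition rho < 1 keeps the exponential moments of the squares finite. *)
Lemma laurent_massart_exponent (R : realType) (k x : R) : 0 < k -> 0 < x ->
  let rho := 2 * Num.sqrt x / (Num.sqrt k + 2 * Num.sqrt x) in
  0 < rho < 1 /\
  x <= rho * (2 * x + Num.sqrt (k * x)) - k * (rho ^+ 2 / (4 * (1 - rho))).
Proof.
move=> k0 x0 rho.
suff H (a b : R) : 0 < a -> 0 < b -> let rho := 2 * b / (a + 2 * b) in
    0 < rho < 1 /\ b ^+ 2 <=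
    rho * (2 * b ^+ 2 + a * b) - a ^+ 2 * (rho ^+ 2 / (4 * (1 - rho))).
  have /= := H (Num.sqrt k) (Num.sqrt x).
  by rewrite !sqrtr_gt0 !sqr_sqrtr ?(ltW k0) ?(ltW x0)// -sqrtrM ?(ltW k0)//; apply.
move=> a0 b0 {}rho.
have ab : 0 < a + 2 * b by lra.
have rhoE : 1 - rho = a / (a + 2 * b) by rewrite /rho; field; rewrite gt_eqF.
split.
  rewrite divr_gt0 ?mulr_gt0//= -subr_gt0 rhoE divr_gt0//.
rewrite rhoE -subr_ge0.
have -> : rho * (2 * b ^+ 2 + a * b) - a ^+ 2 * (rho ^+ 2 / (4 * (a / (a + 2 * b)))) - b ^+ 2
    = 2 * b ^+ 3 / (a + 2 * b).
  by rewrite /rho; field; rewrite !gt_eqF.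
by rewrite divr_ge0 ?mulr_ge0 ?exprn_ge0 ?ltW.
Qed.

End real_inequalities.

(** * Chernoff bounds for quadratic forms of the noise *)

Section gaussian_tail.
Local Open Scope classical_set_scope.
Context d (T : measurableType d) (R : realType) (P : probability T R).
Context n (W : 'I_n -> {RV P >-> R}) (s : R).
Hypothesis iidW : iid_centered_normal W s.
Hypothesis s0 : 0 < s.

(** The first-order parts of the logarithmic moments add up to the contribution of the mean, which
    cancels the term S of the threshold. The quadratic remainder is at most k rho^2 / (4 (1 - rho)),
    because S / m is at most k. *)
Lemma gaussian_orthogonal_tail k (B : 'M[R]_(n, k)) (m x : R) :
  (0 < k)%N -> 0 < m -> 0 < x ->
  (forall l l', l != l' -> \sum_i B i l * B i l' = 0) ->
  (forall l, \sum_i B i l ^+ 2 <= m) ->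
  (P [set w | (s ^+ 2 * (\sum_l \sum_i B i l ^+ 2
                + 2 * m * (2 * x + Num.sqrt (k%:R * x)))
       <= \sum_l (\sum_i B i l * W i w) ^+ 2)%R] <= (expR (- x))%:E)%E.
Proof.
move=> k0 m0 x0 orthB Bm.
have kR : 0 < k%:R :> R by rewrite ltr0n.
have [/andP[]] := laurent_massart_exponent kR x0.
set rho := 2 * _ / _ => rho0 rho1 rhox.
pose D l := \sum_i B i l ^+ 2; pose S := \sum_l D l.
pose Q w := \sum_l (\sum_i B i l * W i w) ^+ 2.
set y := 2 * x + _ in rhox *; clearbody rho y.
pose a := s ^+ 2 * (S + 2 * m * y); rewrite -/S -/a.
(* This normalisation makes the variances of the rescaled forms [u l = rho * (D l / m)], all at most
   rho and hence below 1. *)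
pose tau := rho / (s ^+ 2 * m).
have s2 : 0 < s ^+ 2 by rewrite exprn_gt0.
have tau0 : 0 < tau by rewrite divr_gt0 ?mulr_gt0.
have D0 l : 0 <= D l by apply: sumr_ge0 => i _; exact: sqr_ge0.
pose u l := rho * (D l / m).
have u0 l : 0 <= u l by rewrite mulr_ge0 ?(ltW rho0)// divr_ge0 ?(ltW m0).
have urho l : u l <= rho by rewrite ler_piMr ?(ltW rho0)// ler_pdivrMr// mul1r Bm.
have u1 l : u l < 1 := le_lt_trans (urho l) rho1.
have DE l : s ^+ 2 * (\sum_i (Num.sqrt tau *: B) i l ^+ 2) = u l.
  under eq_bigr do rewrite mxE exprMn sqr_sqrtr ?(ltW tau0)//.
  by rewrite -mulr_sumr -/(D l) /u /tau; field; rewrite !gt_eqF.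
have mgf : (\int[P]_w (expR (tau * Q w / 2))%:E
    = (\prod_l (Num.sqrt (1 - u l))^-1)%:E)%E.
  have := @gaussian_vector_square_mgf _ _ _ _ _ _ _ iidW (lt0r_neq0 s0) _ (Num.sqrt tau *: B).
  under [in X in _ -> _ -> X]eq_bigr do rewrite DE.
  move=> <-.
  - apply: eq_integral => w _; congr (expR (_ / 2))%:E.
    rewrite mulr_sumr; apply: eq_bigr => l _.
    rewrite -[X in X * _](sqr_sqrtr (ltW tau0)) -exprMn mulr_sumr; congr (_ ^+ 2).
    by apply: eq_bigr => i _; rewrite mxE mulrA.
  - move=> l l' ll'; under eq_bigr do rewrite !mxE mulrACA.
    by rewrite -mulr_sumr orthB ?mulr0.
  - by move=> l; rewrite DE.
have mQ : measurable_fun [set: T] Q.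
  apply: measurable_sum => l; apply: measurable_funX.
  by apply: measurable_sum => i; apply: measurable_funM.
have mA : measurable [set w | a <= Q w].
  have := mQ measurableT `[a, +oo[ (measurable_itv _).
  rewrite setTI (_ : _ @^-1` _ = [set w | a <= Q w])//.
  by apply/seteqP; split => w /=; rewrite in_itv/= andbT.
have markov : ((expR (tau * a / 2))%:E * P [set w | (a <= Q w)%R]
    <= (\prod_l (Num.sqrt (1 - u l))^-1)%:E)%E.
  rewrite -mgf -[X in P X]setIT -integral_indic// -ge0_integralZl_EFin ?expR_ge0//.
  - apply: ge0_le_integral => //.
    + apply: measurable_funeM; apply/measurable_EFinP; exact: measurable_indic.
    + apply/measurable_EFinP; apply: measurableT_comp => //.
      by apply: measurable_funM => //; exact: measurable_funM.
    move=> w _; rewrite -EFinM lee_fin indicE.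
    have [|_] := boolP (w \in _); last by rewrite mulr0 expR_ge0.
    rewrite inE /= => aQ; rewrite mulr1 ler_expR ler_pM2r ?invr_gt0//.
    by rewrite ler_pM2l.
  - apply/measurable_EFinP; exact: measurable_indic.
(* In u^2 / (2 (1 - u)) one factor u is kept and the rest, increasing in u, is evaluated at rho; the
   exponent then depends on the [D l] only through their sum S. *)
have prod_le : \prod_l (Num.sqrt (1 - u l))^-1
    <= expR (rho * (S / m) * (1 + rho / (2 * (1 - rho))) / 2).
  have -> : rho * (S / m) * (1 + rho / (2 * (1 - rho))) / 2
      = \sum_l u l * (1 + rho / (2 * (1 - rho))) / 2.
    by rewrite -!mulr_suml -mulr_sumr -mulr_suml.
  rewrite expR_sum; apply: ler_prod => l _.
  rewrite invr_ge0 sqrtr_ge0/=; apply: le_trans (inv_sqrt_le_expR _) _.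
    by rewrite u0 u1.
  rewrite ler_expR ler_pM2r ?invr_gt0// [leRHS]mulrDr mulr1 lerD2l expr2 -mulrA ler_wpM2l//.
  rewrite ler_pdivrMr ?mulr_gt0 ?subr_gt0// mulrAC ler_pdivlMr ?mulr_gt0 ?subr_gt0//.
  have := urho l; nra.
have tauE : tau * a / 2 = rho * (S / m) / 2 + rho * y.
  by rewrite /tau /a; field; rewrite (gt_eqF m0) (gt_eqF s0).
have Sm : S / m <= k%:R.
  rewrite ler_pdivrMr//; apply: le_trans (_ : \sum_(l < k) m <= _).
    by apply: ler_sum => l _; exact: Bm.
  by rewrite sumr_const card_ord mulr_natl.
rewrite -(@lee_pmul2l _ (expR (tau * a / 2))%:E) ?lte_fin ?expR_gt0 ?fin_num_EFin//.
apply: le_trans markov _; rewrite -EFinM lee_fin; apply: le_trans prod_le _.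
rewrite -expRD ler_expR tauE.
have : rho ^+ 2 / (4 * (1 - rho)) * (S / m) <= rho ^+ 2 / (4 * (1 - rho)) * k%:R.
  by rewrite ler_wpM2l// divr_ge0 ?sqr_ge0 ?mulr_ge0 ?subr_ge0 ?(ltW rho1).
have -> : rho * (S / m) * (1 + rho / (2 * (1 - rho))) / 2
    = rho * (S / m) / 2 + rho ^+ 2 / (4 * (1 - rho)) * (S / m).
  by field; rewrite !gt_eqF ?subr_gt0.
move: rhox; lra.
Qed.

End gaussian_tail.

Section gram_tail.
Local Open Scope classical_set_scope.
Context d (T : measurableType d) (R : realType) (P : probability T R).
Context n (W : 'I_n -> {RV P >-> R}) (s : R).
Hypothesis iidW : iid_centered_normal W s.
Hypothesis s0 : 0 < s.

(** The columns of [B = Z *m Q^T] are orthogonal, with squared lengths n times the eigenvalues of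
    [Psi]. So the trace enters as their sum and the spectral norm as their bound, and the rotation
    by Q leaves the norm of Z^T W unchanged. *)
Lemma gaussian_gram_tail k (Z : 'M[R]_(n, k)) (x : R) :
  let Psi := n%:R^-1 *: (Z^T *m Z) in
  (0 < n)%N -> (0 < k)%N -> 0 < x -> 0 < spectral_norm Psi ->
  (P [set w | (s ^+ 2 * (n%:R * (\tr Psi
                + 2 * spectral_norm Psi * (2 * x + Num.sqrt (k%:R * x))))
       <= enorm (Z^T *m \col_i W i w) ^+ 2)%R] <= (expR (- x))%:E)%E.
Proof.
move=> Psi n0 k0 x0 m0; have nR : 0 < n%:R :> R by rewrite ltr0n.
have sPsi : Psi^T = Psi by rewrite /Psi linearZ /= trmx_mul trmxK.
have [Q [D [QQ QD]]] := symmetric_spectral sPsi.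
have QQ' : Q^T *m Q = 1%:M by rewrite mulmx1C.
pose B := Z *m Q^T.
have BB : B^T *m B = n%:R *: diag_mx D.
  rewrite /B trmx_mul trmxK -QD /Psi -scalemxAr -scalemxAl scalerA divff ?gt_eqF//.
  by rewrite scale1r !mulmxA.
have BBE l l' : \sum_i B i l * B i l' = n%:R * (D 0 l *+ (l == l')).
  move/matrixP/(_ l l') : BB; rewrite !mxE => <-.
  by apply: eq_bigr => i _; rewrite [B^T _ _]mxE.
have trE : \sum_l \sum_i B i l ^+ 2 = n%:R * \tr Psi.
  have -> : \tr Psi = \tr (diag_mx D) by rewrite -QD mxtrace_mulC mulmxA QQ' mul1mx.
  rewrite mxtrace_diag mulr_sumr; apply: eq_bigr => l _.
  by under eq_bigr do rewrite expr2; rewrite BBE eqxx mulr1n.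
have Dle l : D 0 l <= spectral_norm Psi.
  pose v := col l Q^T.
  have v1 : enorm v = 1.
    apply/eqP; rewrite -(@eqrXn2 _ 2) ?enorm_ge0// sqr_enorm expr1n.
    move/matrixP/(_ l l) : QQ; rewrite !mxE eqxx mulr1n => QQl; rewrite -[eqbRHS]QQl.
    by apply/eqP; apply: eq_bigr => i _; rewrite !mxE.
  have Pv : Psi *m v = D 0 l *: v.
    have PQ : Psi *m Q^T = Q^T *m diag_mx D by rewrite -QD !mulmxA QQ' mul1mx.
    apply/colP => i; transitivity ((Psi *m Q^T) i l).
      by rewrite [LHS]mxE [RHS]mxE; apply: eq_bigr => j _; rewrite [v _ _]mxE.
    by rewrite PQ mul_mx_diag !mxE mulrC.
  apply: le_trans (ler_norm _) _; rewrite -[leLHS]mulr1 -v1 -enormZ -Pv.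
  by apply: enorm_le_spectral_norm; rewrite v1.
have normE w : enorm (Z^T *m \col_i W i w) ^+ 2 = \sum_l (\sum_i B i l * W i w) ^+ 2.
  have -> : \sum_l (\sum_i B i l * W i w) ^+ 2 = enorm (B^T *m \col_i W i w) ^+ 2.
    rewrite sqr_enorm; apply: eq_bigr => l _; rewrite expr2 mxE.
    by congr (_ * _); apply: eq_bigr => i _; rewrite !mxE.
  rewrite /B trmx_mul trmxK -mulmxA; set v := Z^T *m _.
  by rewrite !sqr_enorm dotv_mulmx mulmxA QQ' mul1mx.
under eq_fun do rewrite normE mulrDr -trE.
have := @gaussian_orthogonal_tail _ _ _ _ _ _ _ iidW s0 _ B (n%:R * spectral_norm Psi) x
  k0 (mulr_gt0 nR m0) x0 _ _.
have -> : n%:R * (2 * spectral_norm Psi * (2 * x + Num.sqrt (k%:R * x)))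
  = 2 * (n%:R * spectral_norm Psi) * (2 * x + Num.sqrt (k%:R * x)) by ring.
apply.
- by move=> l l' /negbTE ll'; rewrite BBE ll' mulr0n mulr0.
- move=> l; under eq_bigr do rewrite expr2.
  by rewrite BBE eqxx mulr1n ler_pM2l.
Qed.

End gram_tail.

(** * Optimality conditions of the Group Lasso *)

Section groups.
Context (R : realType) (N K M : nat) (G : 'I_M -> {set 'I_K}).
Hypothesis hG : is_group_partition G.
Implicit Types (X : 'M[R]_(N, K)) (b : 'cV[R]_K).

Lemma mem_some_group k : exists j, k \in G j.
Proof.
have [_ /and3P[/eqP cov _ _]] := hG.
have : k \in finset.cover (G @: 'I_M) by rewrite cov inE.
by move=> /finset.bigcupP[_ /imsetP[j _ ->] kj]; exists j.
Qed.

Lemma group_inj k j j' : k \in G j -> k \in G j' -> j = j'.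
Proof.
move=> kj kj'; have [injG /and3P[_ /finset.trivIsetP tG _]] := hG.
apply: contraTeq kj' => jj'.
have := tG (G j) (G j') (imset_f _ _) (imset_f _ _).
rewrite (inj_eq injG) => /(_ isT isT jj') /disjointFr -> //.
Qed.

Lemma group_card_gt0 j : (0 < #|G j|)%N.
Proof.
have [_ /and3P[_ _ n0]] := hG; rewrite card_gt0.
by apply: contra n0 => /eqP <-; apply: imset_f.
Qed.

Lemma sum_groups (F : 'I_K -> R) : \sum_j \sum_(k in G j) F k = \sum_k F k.
Proof.
rewrite (exchange_big_dep xpredT)//=; apply: eq_bigr => k _.
have [j kj] := mem_some_group k.
rewrite (big_pred1 j)// => j'; apply/idP/eqP => [kj'|-> //].
exact: (group_inj kj').
Qed.

Lemma group_blockZ a b j : group_block G (a *: b) j = a *: group_block G b j.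
Proof. by apply/colP => t; rewrite !mxE. Qed.

Lemma group_blockB b b' j : group_block G (b - b') j = group_block G b j - group_block G b' j.
Proof. by apply/colP => t; rewrite !mxE. Qed.

Lemma mulmx_groups X b : X *m b = \sum_j group_cols G X j *m group_block G b j.
Proof.
apply/colP => i; rewrite summxE mxE -sum_groups; apply: eq_bigr => j _.
by rewrite big_enum_val !mxE; apply: eq_bigr => t _; rewrite !mxE.
Qed.

Lemma group_block_trmx_mul X (v : 'cV[R]_N) j :
  group_block G (X^T *m v) j = (group_cols G X j)^T *m v.
Proof. by apply/colP => t; rewrite !mxE; apply: eq_bigr => i _; rewrite !mxE. Qed.

(** A perturbation along such a vector alters the penalty of group j only. *)
Definition extend_block b j : 'cV[R]_K := \col_k (if k \in G j then b k 0 else 0).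

Lemma group_block_extend b j : group_block G (extend_block b j) j = group_block G b j.
Proof. by apply/colP => t; rewrite !mxE enum_valP. Qed.

Lemma group_block_extend_neq b j j' : j' != j ->
  group_block G (extend_block b j) j' = 0.
Proof.
move=> jj'; apply/colP => t; rewrite !mxE; case: ifP => // kj.
by have /eqP := group_inj (enum_valP t) kj; rewrite (negbTE jj').
Qed.

Lemma mulmx_extend X b j :
  X *m extend_block b j = group_cols G X j *m group_block G b j.
Proof.
rewrite mulmx_groups (bigD1 j)//= group_block_extend big1 ?addr0// => j' jj'.
by rewrite group_block_extend_neq// mulmx0.
Qed.

Lemma dotv_cross_gram X j j' a c : (0 < N)%N ->
  dotv (group_cols G X j *m a) (group_cols G X j' *m c)
    = N%:R * dotv a (cross_gram G X j j' *m c).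
Proof.
move=> N0; rewrite dotv_mulmx /cross_gram mulmxA -scalemxAl dotvZr mulrA.
by rewrite divff ?mul1r// pnatr_eq0 -lt0n.
Qed.

Section lasso.
Variables (lam : 'I_M -> R) (X : 'M[R]_(N, K)) (y : 'cV[R]_N) (bhat : 'cV[R]_K).
Hypothesis N0 : (0 < N)%N.
Hypothesis lam0 : forall j, 0 < lam j.
Hypothesis sol : GL_solution lam G X y bhat.

Let NR : 0 < N%:R :> R. Proof. by rewrite ltr0n. Qed.

(** Stationarity without subgradients: [bhat] is compared with a step of size e against the gradient
    of the quadratic part, restricted to group j. The penalty grows at most linearly by the triangle
    inequality, and dividing by e and letting e tend to 0 removes the second-order term. *)
Lemma GL_solution_kkt j :
  enorm ((group_cols G X j)^T *m (X *m bhat - y)) <= N%:R * lam j.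
Proof.
set r := X *m bhat - y; set g := _ *m r.
pose h := extend_block (X^T *m r) j.
have hj : group_block G h j = g by rewrite group_block_extend group_block_trmx_mul.
have Xh : X *m h = group_cols G X j *m g by rewrite mulmx_extend group_block_trmx_mul.
have step e : 0 < e ->
    2 * enorm g ^+ 2 <= e * enorm (X *m h) ^+ 2 + 2 * (N%:R * lam j) * enorm g.
  move=> e0; have := sol (bhat - e *: h); rewrite /GL_objective.
  have -> : X *m (bhat - e *: h) - y = r - e *: (X *m h).
    by rewrite mulmxBr -scalemxAr addrAC.
  have -> : enorm (r - e *: (X *m h)) ^+ 2 =
      enorm r ^+ 2 - 2 * e * enorm g ^+ 2 + e ^+ 2 * enorm (X *m h) ^+ 2.
    rewrite sqr_enormD dotvNr dotvZr enormN enormZ Xh dotvC dotv_mulmx -sqr_enorm.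
    by rewrite exprMn real_normK ?num_real//; ring.
  rewrite (bigD1 j)//= [X in _ <= _ + 2 * X](bigD1 j)//=.
  set Sx := \sum_(i | _) _; set Sx' := \sum_(i | _) _.
  have -> : Sx' = Sx.
    apply: eq_bigr => i ij; rewrite group_blockB group_blockZ group_block_extend_neq//.
    by rewrite scaler0 subr0.
  rewrite group_blockB group_blockZ hj => ineq.
  have tri : enorm (group_block G bhat j - e *: g) <= enorm (group_block G bhat j) + e * enorm g.
    by apply: le_trans (enormD _ _) _; rewrite enormN enormZ ger0_norm ?(ltW e0).
  have {tri} := ler_wpM2l (ltW (lam0 j)) tri => tri.
  have {ineq} : 0 <= N%:R^-1 * (- 2 * e * enorm g ^+ 2 + e ^+ 2 * enorm (X *m h) ^+ 2)
      + 2 * (lam j * (e * enorm g)) by lra.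
  have -> : N%:R^-1 * (- 2 * e * enorm g ^+ 2 + e ^+ 2 * enorm (X *m h) ^+ 2)
      + 2 * (lam j * (e * enorm g)) =
     (e / N%:R) * (e * enorm (X *m h) ^+ 2 + 2 * (N%:R * lam j) * enorm g - 2 * enorm g ^+ 2).
    by field; rewrite gt_eqF.
  by rewrite pmulr_rge0 ?divr_gt0// subr_ge0.
have [g0|gn0] := eqVneq (enorm g) 0; first by rewrite g0 mulr_ge0 ?ltW.
have gp : 0 < enorm g by rewrite lt_neqAle eq_sym gn0 enorm_ge0.
rewrite -(ler_pM2r gp) -expr2.
suff : 2 * enorm g ^+ 2 <= 2 * (N%:R * lam j * enorm g) by rewrite ler_pM2l.
apply/ler_addgt0Pr => e e0.
(* The added 1 keeps the step size well defined when [X *m h] is zero. *)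
have C0 : 0 < enorm (X *m h) ^+ 2 + 1 by rewrite ltr_wpDl ?sqr_ge0.
have := step (e / (enorm (X *m h) ^+ 2 + 1)) (divr_gt0 e0 C0).
have : e / (enorm (X *m h) ^+ 2 + 1) * enorm (X *m h) ^+ 2 <= e.
  by rewrite mulrAC ler_pdivrMr// ler_pM2l// lerDl.
lra.
Qed.

Variables (bstar : 'cV[R]_K) (w : 'cV[R]_N).
Hypothesis yE : y = X *m bstar + w.
Hypothesis noise : forall j, enorm ((group_cols G X j)^T *m w) <= N%:R * lam j / 2.

Let D := bhat - bstar.
Let a j := enorm (group_block G D j).

(** The 3 / 2 is 1 from stationarity plus 1 / 2 from the noise; it is the first term of [gl_c]. *)
Lemma GL_gram_error_le j :
  enorm ((group_cols G X j)^T *m (X *m D)) <= 3 / 2 * N%:R * lam j.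
Proof.
have -> : X *m D = (X *m bhat - y) + w.
  by rewrite yE /D mulmxBr opprD addrA subrK.
rewrite mulmxDr; apply: le_trans (enormD _ _) _.
have := GL_solution_kkt j; have := noise j; lra.
Qed.

(** Comparing the objective at [bhat] and [bstar], the noise costs at most one copy of the weighted
    sum of the [a j], and a second copy is added to both sides. Off the support these copies cancel
    against the penalty of [bhat]; on it the triangle inequality doubles them. Dropping the
    quadratic term leaves the cone inequality with factor 3. *)
Lemma GL_basic_inequality :
  N%:R^-1 * enorm (X *m D) ^+ 2 + \sum_j lam j * a j
    <= 4 * \sum_(j in group_supp G bstar) lam j * a j.
Proof.
have := sol bstar; rewrite /GL_objective.
have -> : X *m bhat - y = X *m D - w by rewrite yE /D mulmxBr opprD addrA.
have -> : X *m bstar - y = - w by rewrite yE opprD addrA subrr add0r.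
rewrite enormN.
have -> : enorm (X *m D - w) ^+ 2 = enorm (X *m D) ^+ 2 - 2 * dotv (X *m D) w + enorm w ^+ 2.
  by rewrite sqr_enormD dotvNr enormN mulrN.
have cross : dotv (X *m D) w <= N%:R * \sum_j lam j * a j / 2.
  rewrite mulmx_groups dotv_suml mulr_sumr; apply: ler_sum => j _.
  rewrite dotv_mulmx; apply: le_trans (ler_norm _) _; apply: le_trans (dotv_le _ _) _.
  rewrite -/(a j); have := ler_wpM2l (enorm_ge0 (group_block G D j)) (noise j).
  rewrite -/(a j); lra.
have {}cross : N%:R^-1 * dotv (X *m D) w <= \sum_j lam j * a j / 2.
  by rewrite mulrC ler_pdivrMr// mulrC.
rewrite -mulr_suml in cross.
have supp : \sum_j lam j * a j + \sum_j lam j * enorm (group_block G bstar j)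
     - \sum_j lam j * enorm (group_block G bhat j)
   <= 2 * \sum_(j in group_supp G bstar) lam j * a j.
  rewrite -big_split -sumrB mulr_sumr [leRHS]big_mkcond; apply: ler_sum => j _ /=.
  rewrite inE; have Dj : group_block G D j = group_block G bhat j - group_block G bstar j.
    exact: group_blockB.
  case: eqVneq => [b0|_] /=.
    by rewrite /a Dj b0 subr0 enorm0 mulr0 addr0 subrr.
  have : enorm (group_block G bstar j) <= enorm (group_block G bhat j) + a j.
    rewrite /a -[enorm (group_block G D j)]enormN.
    have -> : group_block G bstar j = group_block G bhat j + - group_block G D j.
      by rewrite Dj opprB addrC subrK.
    exact: enormD.
  move=> h; have := ler_wpM2l (ltW (lam0 j)) h; lra.
move: cross supp; set s1 := \sum_j lam j * a j; set s2 := \sum_(j in _) _.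
move: (\sum_j _) (\sum_j _) => s3 s4; lra.
Qed.

End lasso.
End groups.

(** * Consequences of coherence *)

(** The index ranges may differ in length: an index i not below n has no diagonal partner, hence an
    inequality only. *)
Lemma sum_diag_sqr_le (R : realType) m n (x : 'cV[R]_m) :
  \sum_(i < m) \sum_(j < n) (if i == j :> nat then x i 0 ^+ 2 else 0) <= enorm x ^+ 2.
Proof.
rewrite sqr_enorm; apply: ler_sum => i _; rewrite -expr2 -big_mkcond /=.
have [im|ni] := ltnP i n.
  by rewrite (big_pred1 (Ordinal im))// => j; rewrite -val_eqE eq_sym.
rewrite big_pred0 ?sqr_ge0// => j; apply/negbTE.
by rewrite neq_ltn (leq_trans (ltn_ord j) ni) orbT.
Qed.

(** Diagonal and off-diagonal entries account for one L each. The diagonal part is Cauchy-Schwarz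
    over pairs of equal indices; off the diagonal, the factor 1 / sqrt (m n) offsets the sqrt m and
    sqrt n lost in passing from sums of absolute values to Euclidean norms. *)
Lemma dotv_mulmx_le (R : realType) m n (E : 'M[R]_(m, n)) (L : R) x z :
  0 <= L ->
  (forall (i : 'I_m) (j : 'I_n), i = j :> nat -> `|E i j| <= L) ->
  (forall (i : 'I_m) (j : 'I_n), i <> j :> nat ->
     `|E i j| <= L / Num.sqrt (m%:R * n%:R)) ->
  `|dotv x (E *m z)| <= 2 * L * enorm x * enorm z.
Proof.
move=> L0 Ediag Eoff.
pose r := (Num.sqrt (m%:R * n%:R : R))^-1.
have r0 : 0 <= r by rewrite invr_ge0 sqrtr_ge0.
pose dg (i : 'I_m) (j : 'I_n) := (i == j :> nat).
have l1 k (v : 'cV[R]_k) : \sum_i `|v i 0| <= Num.sqrt k%:R * enorm v.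
  rewrite -(@ler_pXn2r _ 2) ?nnegrE ?mulr_ge0 ?enorm_ge0 ?sqrtr_ge0 ?sumr_ge0//.
  rewrite exprMn sqr_sqrtr ?ler0n// sqr_enorm.
  apply: le_trans (sqr_sum_le_card 'I_k (fun i => `|v i 0|)) _.
  rewrite card_ord (eq_bigr (fun i => v i 0 * v i 0)) => [|i _]; first exact: lexx.
  by rewrite real_normK ?num_real// expr2.
have diag : \sum_i \sum_j (if dg i j then `|x i 0| * `|z j 0| else 0) <= enorm x * enorm z.
  rewrite -(@ler_pXn2r _ 2) ?nnegrE ?mulr_ge0 ?enorm_ge0//; last first.
    by apply: sumr_ge0 => i _; apply: sumr_ge0 => j _; case: ifP => // _; rewrite mulr_ge0.
  rewrite pair_bigA exprMn /=.
  have := sqr_sum_mul_le (fun p : 'I_m * 'I_n => if dg p.1 p.2 then `|x p.1 0| else 0)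
     (fun p => if dg p.1 p.2 then `|z p.2 0| else 0).
  rewrite (eq_bigr (fun p => if dg p.1 p.2 then `|x p.1 0| * `|z p.2 0| else 0)); last first.
    by move=> p _; case: ifP => //; rewrite mul0r.
  move=> /le_trans; apply; apply: ler_pM.
  - by apply: sumr_ge0 => p _; rewrite sqr_ge0.
  - by apply: sumr_ge0 => p _; rewrite sqr_ge0.
  - apply: le_trans (sum_diag_sqr_le n x); rewrite pair_bigA /=; apply: ler_sum => p _.
    by rewrite /dg; case: ifP => _; rewrite ?expr0n// real_normK ?num_real.
  - apply: le_trans (sum_diag_sqr_le m z); rewrite exchange_big pair_bigA /=; apply: ler_sum => p _.
    by rewrite /dg eq_sym; case: ifP => _; rewrite ?expr0n// real_normK ?num_real.
(* The off-diagonal allowance is granted on the diagonal too, so that its double sum factors. *)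
have step : `|dotv x (E *m z)| <= \sum_i \sum_j
    (L * (if dg i j then `|x i 0| * `|z j 0| else 0) + L * r * (`|x i 0| * `|z j 0|)).
  apply: le_trans (ler_norm_sum _ _ _) _; apply: ler_sum => i _.
  rewrite mxE mulr_sumr; apply: le_trans (ler_norm_sum _ _ _) _; apply: ler_sum => j _.
  rewrite normrM normrM mulrCA.
  have xz0 : 0 <= `|x i 0| * `|z j 0| by rewrite mulr_ge0.
  rewrite /dg; case: eqP => [ij|ij].
    apply: le_trans (ler_wpM2r xz0 (Ediag _ _ ij)) _.
    by rewrite lerDl mulr_ge0 ?mulr_ge0.
  by rewrite mulr0 add0r; exact: ler_wpM2r (Eoff _ _ ij).
apply: le_trans step _; under eq_bigr do rewrite big_split /=.
rewrite big_split /=.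
have -> : 2 * L * enorm x * enorm z = L * (enorm x * enorm z) + L * (enorm x * enorm z) by ring.
apply: lerD.
  by under eq_bigr do rewrite -mulr_sumr; rewrite -mulr_sumr ler_wpM2l.
under eq_bigr do (rewrite -mulr_sumr -mulr_sumr); rewrite -mulr_sumr -mulr_suml.
rewrite -mulrA ler_wpM2l//.
apply: le_trans (_ : r * ((Num.sqrt m%:R * enorm x) * (Num.sqrt n%:R * enorm z)) <= _).
  by rewrite ler_wpM2l//; apply: ler_pM; rewrite ?l1 ?sumr_ge0.
rewrite mulrACA -sqrtrM ?ler0n// [leLHS]mulrA ler_piMl ?mulr_ge0 ?enorm_ge0//.
rewrite /r; have [->|h] := eqVneq (Num.sqrt (m%:R * n%:R) : R) 0; first by rewrite mulr0.
by rewrite mulVf.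
Qed.

Section penalty_extrema.
Context (R : realType) (M : nat) (lam : 'I_M -> R).
Hypothesis M0 : (0 < M)%N.
Hypothesis lam0 : forall j, 0 < lam j.

Lemma le_lambda_max j : lam j <= lambda_max lam.
Proof. exact: le_bigmax. Qed.

Lemma lambda_min_le j : lambda_min lam <= lam j.
Proof. exact: bigmin_le. Qed.

Lemma lambda_max_gt0 : 0 < lambda_max lam.
Proof. exact: lt_le_trans (lam0 (Ordinal M0)) (le_lambda_max _). Qed.

Lemma lambda_min_gt0 : 0 < lambda_min lam.
Proof. by apply: lt_bigmin => [|j _]; [exact: lambda_max_gt0|exact: lam0]. Qed.

Lemma lambda_min_le_max : lambda_min lam <= lambda_max lam.
Proof. exact: le_trans (lambda_min_le (Ordinal M0)) (le_lambda_max _). Qed.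

End penalty_extrema.

Section coherence.
Context (R : realType) (N K M : nat) (G : 'I_M -> {set 'I_K}).
Context (X : 'M[R]_(N, K)) (lam : 'I_M -> R) (s : nat) (alpha phi : R).
Hypothesis hG : is_group_partition G.
Hypothesis N0 : (0 < N)%N.
Hypothesis M0 : (0 < M)%N.
Hypothesis lam0 : forall j, 0 < lam j.
Hypothesis alpha1 : 1 < alpha.
Hypothesis phi0 : 0 < phi.
Hypothesis coh : coherence lam G X s alpha phi.

Local Notation L := (coherence_level lam s alpha phi).

Let NR : 0 < N%:R :> R. Proof. by rewrite ltr0n. Qed.

Lemma coherence_level_ge0 : 0 <= L.
Proof.
have lmin := lambda_min_gt0 M0 lam0; have lmax := lambda_max_gt0 M0 lam0.
have alpha0 : 0 < alpha by apply: lt_trans alpha1.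
by rewrite divr_ge0 ?mulr_ge0 ?(ltW lmin) ?(ltW lmax) ?(ltW phi0) ?(ltW alpha0).
Qed.

Lemma cross_gram_dotv_le j j' a c : j != j' ->
  `|dotv a (cross_gram G X j j' *m c)| <= 2 * L * enorm a * enorm c.
Proof.
move=> jj'; have [_ _ c1 c2] := coh.
by apply: dotv_mulmx_le => //; [exact: coherence_level_ge0|exact: c1|exact: c2].
Qed.

(** Subtracting [phi%:M] clears the diagonal, and for a square block of size k one has sqrt (k k) =
    k, so the within-group coherence clause takes the form of the cross-group one. *)
Lemma gram_dotv_le j a c :
  `|dotv a (gram G X j *m c) - phi * dotv a c| <= 2 * L * enorm a * enorm c.
Proof.
have [c1 c2 _ _] := coh.
have -> : dotv a (gram G X j *m c) - phi * dotv a c =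
    dotv a ((gram G X j - phi%:M) *m c).
  by rewrite mulmxBl mul_scalar_mx dotvDr dotvNr dotvZr.
have eE t t' : (gram G X j - phi%:M) t t' = gram G X j t t' - phi *+ (t == t').
  by rewrite [LHS]mxE [X in _ + X]mxE [X in - X]mxE.
apply: dotv_mulmx_le => [|t t' /val_inj <-|t t' tt']; first exact: coherence_level_ge0.
  by rewrite eE eqxx c1 subrr normr0 coherence_level_ge0.
have tt : t != t' by apply: contra_not_neq tt' => ->.
by rewrite eE (negbTE tt) subr0 -expr2 sqrtr_sqr normr_nat; exact: c2.
Qed.

Variable D : 'cV[R]_K.
Let n j := enorm (group_block G D j).

Let n0 j : 0 <= n j. Proof. exact: enorm_ge0. Qed.

(** The bounded vector is paired with block j of D itself: its own Gram block yields phi n_j^2,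
    every block perturbs this by at most 2 L n_j n_j', and n_j is divided out. A vanishing block is
    treated apart for that reason. *)
Lemma block_norm_le j :
  enorm ((group_cols G X j)^T *m (X *m D)) <= 3 / 2 * N%:R * lam j ->
  phi * n j <= 3 / 2 * lam j + 2 * L * \sum_j' n j'.
Proof.
move=> kkt; set Dj := group_block G D j.
have [nj0|njn0] := eqVneq (n j) 0.
  rewrite nj0 mulr0; apply: addr_ge0; first by rewrite mulr_ge0 ?ltW.
  by rewrite mulr_ge0 ?sumr_ge0// mulr_ge0 ?coherence_level_ge0.
have nj : 0 < n j by rewrite lt_neqAle eq_sym njn0 n0.
have E : dotv Dj ((group_cols G X j)^T *m (X *m D))
    = N%:R * \sum_j' dotv Dj (cross_gram G X j j' *m group_block G D j').
  rewrite -dotv_mulmx (mulmx_groups hG X D) dotv_sumr mulr_sumr.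
  by apply: eq_bigr => j' _; rewrite dotv_cross_gram.
have up : \sum_j' dotv Dj (cross_gram G X j j' *m group_block G D j')
    <= n j * (3 / 2 * lam j).
  rewrite -(ler_pM2l NR) -E; apply: le_trans (ler_norm _) _.
  apply: le_trans (dotv_le _ _) _.
  have := ler_wpM2l (n0 j) kkt; rewrite -/(n j); lra.
have lo : \sum_j' ((if j == j' then phi * n j ^+ 2 else 0) - 2 * L * n j * n j')
    <= \sum_j' dotv Dj (cross_gram G X j j' *m group_block G D j').
  apply: ler_sum => j' _; case: eqVneq => [<-|jj'].
    have := gram_dotv_le Dj Dj; rewrite -sqr_enorm -/(n j) ler_norml => /andP[+ _].
    by rewrite /gram; lra.
  have := cross_gram_dotv_le Dj (group_block G D j') jj'.
  by rewrite -/(n j) -/(n j') ler_norml => /andP[+ _]; rewrite sub0r.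
rewrite sumrB -mulr_sumr -big_mkcond (big_pred1 j) /= in lo; last by move=> ?; rewrite eq_sym.
rewrite -(ler_pM2l nj); move: lo up; set S := \sum_j' n j'; lra.
Qed.

(** [X *m D] is split into the part u from J and the part v from its complement. The square of u is
    expanded blockwise, twice the product of u and v costs 4 L, and the square of v is dropped. *)
Lemma gram_form_ge (J : {set 'I_M}) :
  phi * \sum_(j in J) n j ^+ 2 - 2 * L * (\sum_(j in J) n j) ^+ 2
    - 4 * L * ((\sum_(j in J) n j) * \sum_(j in ~: J) n j)
  <= N%:R^-1 * enorm (X *m D) ^+ 2.
Proof.
pose Y j := group_cols G X j *m group_block G D j.
pose u := \sum_(j in J) Y j; pose v := \sum_(j in ~: J) Y j.
have XE : X *m D = u + v.
  rewrite (mulmx_groups hG X D) (bigID (mem J))/=; congr (_ + _).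
  by apply: eq_bigl => j; rewrite inE.
have YE j j' : dotv (Y j) (Y j') =
    N%:R * dotv (group_block G D j) (cross_gram G X j j' *m group_block G D j').
  exact: dotv_cross_gram.
have uu : N%:R * (phi * \sum_(j in J) n j ^+ 2 - 2 * L * (\sum_(j in J) n j) ^+ 2)
    <= enorm u ^+ 2.
  rewrite sqr_enorm dotv_suml.
  have -> : N%:R * (phi * \sum_(j in J) n j ^+ 2 - 2 * L * (\sum_(j in J) n j) ^+ 2)
     = \sum_(j in J) (N%:R * (phi * n j ^+ 2 - 2 * L * n j * \sum_(j' in J) n j')).
    by rewrite -mulr_sumr sumrB -mulr_sumr -mulr_suml -mulr_sumr expr2 mulrA.
  apply: ler_sum => j jJ.
  have -> : dotv (Y j) u = N%:R * \sum_(j' in J)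
      dotv (group_block G D j) (cross_gram G X j j' *m group_block G D j').
    by rewrite dotv_sumr mulr_sumr; apply: eq_bigr => j' _; exact: YE.
  rewrite ler_pM2l//.
  have -> : phi * n j ^+ 2 - 2 * L * n j * \sum_(j' in J) n j'
     = \sum_(j' in J) ((if j == j' then phi * n j ^+ 2 else 0) - 2 * L * n j * n j').
    rewrite sumrB -mulr_sumr; congr (_ - _).
    rewrite -big_mkcondr (big_pred1 j)// => j' /=; rewrite [in RHS]eq_sym.
    by case: eqVneq => [<-|_]; rewrite ?jJ ?andbF.
  apply: ler_sum => j' _; case: eqVneq => [<-|jj'].
    have := gram_dotv_le (group_block G D j) (group_block G D j).
    by rewrite -sqr_enorm -/(n j) ler_norml => /andP[+ _]; rewrite /gram; lra.
  have := cross_gram_dotv_le (group_block G D j) (group_block G D j') jj'.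
  by rewrite -/(n j) -/(n j') ler_norml => /andP[+ _]; rewrite sub0r.
have uv : - (N%:R * (2 * L * ((\sum_(j in J) n j) * \sum_(j in ~: J) n j))) <= dotv u v.
  have -> : - (N%:R * (2 * L * ((\sum_(j in J) n j) * \sum_(j in ~: J) n j)))
      = \sum_(j in J) \sum_(j' in ~: J) - (N%:R * (2 * L * n j * n j')).
    rewrite mulr_suml !mulr_sumr -sumrN; apply: eq_bigr => j _.
    by rewrite !mulr_sumr -sumrN; apply: eq_bigr => j' _; ring.
  rewrite dotv_suml; apply: ler_sum => j jJ.
  rewrite dotv_sumr; apply: ler_sum => j' j'J.
  have jj' : j != j' by apply: contraTneq j'J => <-; rewrite inE jJ.
  rewrite YE; have := cross_gram_dotv_le (group_block G D j) (group_block G D j') jj'.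
  rewrite -/(n j) -/(n j') ler_norml => /andP[+ _] => h.
  have := ler_wpM2l (ltW NR) h; lra.
rewrite XE sqr_enormD ler_pdivlMl//.
have := sqr_ge0 (enorm v); lra.
Qed.

End coherence.

(** * From the quadratic form to bounds on block norms *)

Section sparse_bounds.
Context (R : realType) (M : nat) (lam n : 'I_M -> R) (J : {set 'I_M}) (s : nat).
Context (alpha phi Q : R).
Hypothesis M0 : (0 < M)%N.
Hypothesis lam0 : forall j, 0 < lam j.
Hypothesis n0 : forall j, 0 <= n j.
Hypothesis s0 : (0 < s)%N.
Hypothesis Js : (#|J| <= s)%N.
Hypothesis alpha1 : 1 < alpha.
Hypothesis phi0 : 0 < phi.
Hypothesis Q0 : 0 <= Q.

Local Notation L := (coherence_level lam s alpha phi).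
Local Notation lmin := (lambda_min lam).
Local Notation lmax := (lambda_max lam).

Hypothesis basic : Q + \sum_j lam j * n j <= 4 * \sum_(j in J) lam j * n j.
Hypothesis form : phi * \sum_(j in J) n j ^+ 2 - 2 * L * (\sum_(j in J) n j) ^+ 2
    - 4 * L * ((\sum_(j in J) n j) * \sum_(j in ~: J) n j) <= Q.

Let lmin0 : 0 < lmin. Proof. exact: lambda_min_gt0. Qed.
Let lmax0 : 0 < lmax. Proof. exact: lambda_max_gt0. Qed.
Let sR : 0 < s%:R :> R. Proof. by rewrite ltr0n. Qed.
Let alpha0 : 0 < alpha. Proof. exact: lt_trans alpha1. Qed.

(** The 14 of the coherence level is 2 + 4 * 3: with e = phi / (14 alpha s), the pure term costs at
    most 2 e A^2 and the mixed one, through the cone, at most 12 e A^2. Since A^2 <= s V, the total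
    loss is at most phi V / alpha. *)
Lemma restricted_eigenvalue_bound :
  phi * (alpha - 1) / alpha * \sum_(j in J) n j ^+ 2 <= Q.
Proof.
have := form; set V := \sum_(j in J) _ ^+ 2; set A := \sum_(j in J) n j.
set B := \sum_(j in ~: J) n j => formQ.
have A0 : 0 <= A by apply: sumr_ge0.
have B0 : 0 <= B by apply: sumr_ge0.
have AV : A ^+ 2 <= s%:R * V.
  apply: le_trans (sqr_sum_le_card _ _) _; rewrite ler_wpM2r ?ler_nat//.
  by apply: sumr_ge0 => j _; exact: sqr_ge0.
have cone : lmin * B <= 3 * (lmax * A).
  have split : \sum_j lam j * n j
      = \sum_(j in J) lam j * n j + \sum_(j in ~: J) lam j * n j.
    by rewrite (bigID (mem J))/=; congr (_ + _); apply: eq_bigl => j; rewrite inE.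
  have lo : lmin * B <= \sum_(j in ~: J) lam j * n j.
    by rewrite mulr_sumr; apply: ler_sum => j _; rewrite ler_wpM2r ?lambda_min_le.
  have hi : \sum_(j in J) lam j * n j <= lmax * A.
    by rewrite mulr_sumr; apply: ler_sum => j _; rewrite ler_wpM2r ?le_lambda_max.
  by move: basic lo hi Q0; rewrite split; lra.
pose e := phi / (14 * alpha * s%:R).
have e0 : 0 < e by rewrite divr_gt0 ?mulr_gt0.
have LE : L = lmin / lmax * e.
  by rewrite /coherence_level /e; field; rewrite !gt_eqF.
have L_le : L <= e.
  rewrite LE ler_piMl ?(ltW e0)// ler_pdivrMr// mul1r.
  exact: lambda_min_le_max.
have LB : L * B <= 3 * e * A.
  have -> : L * B = e / lmax * (lmin * B) by rewrite LE; ring.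
  have -> : 3 * e * A = e / lmax * (3 * (lmax * A)) by field; rewrite gt_eqF.
  by rewrite ler_wpM2l// divr_ge0 ?ltW.
have eV : e * A ^+ 2 <= phi / (14 * alpha) * V.
  have -> : phi / (14 * alpha) * V = e * (s%:R * V).
    by rewrite /e; field; rewrite !gt_eqF.
  by rewrite ler_wpM2l ?(ltW e0).
apply: le_trans formQ.
have -> : phi * (alpha - 1) / alpha * V = phi * V - 14 * (phi / (14 * alpha) * V).
  by field; rewrite gt_eqF.
have h1 := ler_wpM2r (sqr_ge0 A) L_le.
have h2 := ler_wpM2r A0 LB.
move: h1 h2 eV; rewrite expr2; lra.
Qed.

(** Completing the square splits 4 lam n into 4 lam^2 / kappa + kappa n^2, and the second part,
    summed over J, is absorbed by Q. This gives the constant 4, relaxed to the 16 of [gl_c1] at the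
    end. *)
Lemma sum_block_norm_le :
  \sum_j n j <= 16 * alpha / (alpha - 1) * (\sum_(j in J) lam j ^+ 2) / (phi * lmin).
Proof.
set S := \sum_(j in J) _.
pose kappa := phi * (alpha - 1) / alpha.
have k0 : 0 < kappa by rewrite divr_gt0// mulr_gt0// subr_gt0.
have S0 : 0 <= S by apply: sumr_ge0 => j _; exact: sqr_ge0.
have amgm : 4 * \sum_(j in J) lam j * n j
    <= 4 * S / kappa + kappa * \sum_(j in J) n j ^+ 2.
  rewrite !mulr_sumr mulr_suml -big_split; apply: ler_sum => j _ /=.
  rewrite -subr_ge0.
  have -> : 4 * lam j ^+ 2 / kappa + kappa * n j ^+ 2 - 4 * (lam j * n j)
     = (2 * lam j - kappa * n j) ^+ 2 / kappa by field; rewrite gt_eqF.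
  by rewrite divr_ge0 ?sqr_ge0 ?ltW.
have lo : lmin * \sum_j n j <= \sum_j lam j * n j.
  by rewrite mulr_sumr; apply: ler_sum => j _; rewrite ler_wpM2r ?lambda_min_le.
have h : lmin * \sum_j n j <= 4 * S / kappa.
  by have := restricted_eigenvalue_bound; rewrite -/kappa; move: basic amgm lo; lra.
have -> : 16 * alpha / (alpha - 1) * S / (phi * lmin) = 16 * S / kappa / lmin.
  by rewrite /kappa; field; rewrite !gt_eqF ?subr_gt0.
rewrite ler_pdivlMr// mulrC; apply: le_trans h _.
rewrite ler_pM2r ?invr_gt0//; lra.
Qed.

(** The second term of [gl_c] is 2 L times the bound on the sum of all norms: 2 * 16 / 14 = 16 / 7,
    while [lambda_min], phi and alpha cancel, and s cancels once each squared weight in J is bounded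
    by that of [lambda_max]. *)
Lemma block_norm_le_lambda_max j :
  phi * n j <= 3 / 2 * lam j + 2 * L * \sum_j n j ->
  n j <= gl_c alpha / phi * lmax.
Proof.
move=> kkt; set S := \sum_(j in J) lam j ^+ 2.
have SS : S <= s%:R * lmax ^+ 2.
  apply: le_trans (_ : \sum_(j in J) lmax ^+ 2 <= _).
    apply: ler_sum => i _; rewrite ler_pXn2r ?nnegrE ?(ltW (lam0 _)) ?(ltW lmax0)//.
    exact: le_lambda_max.
  by rewrite sumr_const -[leLHS]mulr_natl ler_wpM2r ?sqr_ge0 ?ler_nat.
have L0 : 0 <= L by rewrite divr_ge0 ?mulr_ge0 ?(ltW lmin0) ?(ltW lmax0) ?(ltW phi0) ?(ltW alpha0).
have am0 : 0 < alpha - 1 by rewrite subr_gt0.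
have up : 2 * L * \sum_j n j <= 16 / (7 * (alpha - 1)) * lmax.
  have L20 : 0 <= 2 * L by rewrite mulr_ge0.
  apply: le_trans (ler_wpM2l L20 sum_block_norm_le) _; rewrite -/S.
  have -> : 2 * L * (16 * alpha / (alpha - 1) * S / (phi * lmin))
     = 16 / (7 * (alpha - 1)) / (lmax * s%:R) * S.
    by rewrite /coherence_level; field; rewrite !gt_eqF.
  have -> : 16 / (7 * (alpha - 1)) * lmax
     = 16 / (7 * (alpha - 1)) / (lmax * s%:R) * (s%:R * lmax ^+ 2).
    by field; rewrite !gt_eqF.
  by rewrite ler_wpM2l// !divr_ge0 ?mulr_ge0 ?(ltW am0) ?(ltW lmax0).
rewrite -(ler_pM2l phi0).
have -> : phi * (gl_c alpha / phi * lmax) = 3 / 2 * lmax + 16 / (7 * (alpha - 1)) * lmax.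
  by rewrite /gl_c; field; rewrite !gt_eqF.
have := le_lambda_max lam j; lra.
Qed.

End sparse_bounds.

(** In n^p = n * n^(p - 1) the second factor is at most B^(p - 1); summing and taking the p-th root
    gives the exponents. *)
Lemma mixed_norm_interpolation (R : realType) (I : finType) (n : I -> R) (p A B : R) :
  1 <= p -> (forall j, 0 <= n j) -> (forall j, n j <= B) -> 0 <= B ->
  \sum_j n j <= A ->
  (\sum_j n j `^ p) `^ p^-1 <= A `^ p^-1 * B `^ (1 - p^-1).
Proof.
move=> p1 n0 nB B0 nA.
have p0 : 0 < p by exact: lt_le_trans p1.
have A0 : 0 <= A by apply: le_trans nA; apply: sumr_ge0.
have h : \sum_j n j `^ p <= A * B `^ (p - 1).
  apply: le_trans (_ : (\sum_j n j) * B `^ (p - 1) <= _).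
    rewrite mulr_suml; apply: ler_sum => j _.
    rewrite -mulr_powRB1// ler_wpM2l// ge0_ler_powR ?nnegrE ?subr_ge0//.
  by rewrite ler_wpM2r ?powR_ge0.
apply: le_trans (_ : (A * B `^ (p - 1)) `^ p^-1 <= _).
  rewrite ge0_ler_powR ?nnegrE ?invr_ge0 ?(ltW p0) ?mulr_ge0 ?powR_ge0//.
  by apply: sumr_ge0 => j _; exact: powR_ge0.
rewrite powRM ?powR_ge0// -powRrM mulrBl mul1r divff ?gt_eqF//.
Qed.

(** Both bounds contain the factor [lambda_max lam / phi], whose exponents 1 / p and 1 - 1 / p add
    up to 1; the numerical constants left over make up [gl_c1]. *)
Lemma mixed_norm_le_gl_bound (R : realType) K M (G : 'I_M -> {set 'I_K})
    (D : 'cV[R]_K) (lam : 'I_M -> R) (J : {set 'I_M}) (alpha phi p : R) :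
  (0 < M)%N -> (forall j, 0 < lam j) -> 1 < alpha -> 0 < phi -> 1 <= p ->
  \sum_j enorm (group_block G D j)
    <= 16 * alpha / (alpha - 1) * (\sum_(j in J) lam j ^+ 2) / (phi * lambda_min lam) ->
  (forall j, enorm (group_block G D j) <= gl_c alpha / phi * lambda_max lam) ->
  mixed_norm G p D <= gl_bound lam alpha phi p J.
Proof.
move=> M0 lam0 alpha1 phi0 p1 l1 linf.
have lmin0 := lambda_min_gt0 M0 lam0; have lmax0 := lambda_max_gt0 M0 lam0.
have am0 : 0 < alpha - 1 by rewrite subr_gt0.
have alpha0 : 0 < alpha by exact: lt_trans alpha1.
have c0 : 0 <= gl_c alpha by rewrite /gl_c addr_ge0 ?divr_ge0 ?mulr_ge0 ?(ltW am0).
have r0 : 0 < lambda_max lam / phi by rewrite divr_gt0.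
have B0 : 0 <= gl_c alpha / phi * lambda_max lam.
  by rewrite mulr_ge0 ?divr_ge0 ?(ltW phi0) ?(ltW lmax0).
apply: le_trans (mixed_norm_interpolation p1 _ linf B0 l1) _.
  by move=> j; exact: enorm_ge0.
rewrite /gl_bound /gl_c1 -mulr_suml; set S := \sum_(j in J) _.
have S0 : 0 <= S by apply: sumr_ge0 => j _; exact: sqr_ge0.
pose C := 16 * alpha / (alpha - 1).
have C0 : 0 <= C by rewrite divr_ge0 ?mulr_ge0 ?ltW.
have T0 : 0 <= S / (lambda_min lam * lambda_max lam).
  by rewrite divr_ge0 ?mulr_ge0 ?(ltW lmin0) ?(ltW lmax0).
have -> : 16 * alpha / (alpha - 1) * S / (phi * lambda_min lam)
    = C * (S / (lambda_min lam * lambda_max lam)) * (lambda_max lam / phi).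
  by rewrite /C; field; rewrite !gt_eqF.
rewrite -/C; clearbody C.
have -> : gl_c alpha / phi * lambda_max lam = gl_c alpha * (lambda_max lam / phi) by ring.
move: T0 r0; set t := S / _; set r := lambda_max lam / phi => T0 r0.
have -> : C `^ p^-1 * gl_c alpha `^ (1 - p^-1) / phi * lambda_max lam * t `^ p^-1
    = C `^ p^-1 * gl_c alpha `^ (1 - p^-1) * t `^ p^-1 * r by rewrite /r; ring.
clearbody t r; rewrite !powRM ?mulr_ge0 ?(ltW r0)//.
have rr : r `^ p^-1 * r `^ (1 - p^-1) = r.
  by rewrite -powRD ?subrKC ?powRr1 ?(ltW r0)// gt_eqF ?implybT.
by rewrite -[X in _ <= _ * X]rr le_eqVlt; apply/orP; left; apply/eqP; ring.
Qed.

(** The entry is the pairing of a basis vector with its image. The Gram matrices have positive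
    diagonal, so their spectral norms are positive and the Chernoff parameter may divide by them. *)
Lemma spectral_norm_ge_diag (R : realType) n (A : 'M[R]_n) t :
  A t t <= spectral_norm A.
Proof.
pose e : 'cV[R]_n := delta_mx t 0.
have eE u : dotv e u = u t 0.
  rewrite /dotv (bigD1 t)//= mxE !eqxx mul1r big1 ?addr0// => i it.
  by rewrite mxE (negbTE it) mul0r.
have e1 : enorm e = 1.
  apply/eqP; rewrite -(@eqrXn2 _ 2) ?enorm_ge0// sqr_enorm expr1n eE.
  by rewrite mxE !eqxx.
have AE : (A *m e) t 0 = A t t by rewrite -colE mxE.
rewrite -AE -eE; apply: le_trans (ler_norm _) _; apply: le_trans (dotv_le _ _) _.
by rewrite e1 mul1r enorm_le_spectral_norm ?e1.
Qed.

(** * The noise event *)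

Section union_bound.
Local Open Scope classical_set_scope.
Local Open Scope ereal_scope.
Context d (T : measurableType d) (R : realType) (P : probability T R).

Lemma probability_avoid_ge (I : finType) (B : I -> set T) (e : R) :
  (forall i, measurable (B i)) -> (forall i, P (B i) <= e%:E) ->
  exists A : set T, [/\ measurable A, (forall w, A w -> forall i, ~ B i w) &
    (1 - #|I|%:R * e)%:E <= P A].
Proof.
move=> mB PB; exists (~` \big[setU/set0]_i B i).
have mU : measurable (\big[setU/set0]_i B i) by apply: bigsetU_measurable.
split; first exact: measurableC.
  by move=> w nw i Bi; apply: nw; rewrite (bigD1 i)//; left.
rewrite probability_setC// EFinB leeB//.
apply: le_trans (_ : \sum_i P (B i) <= _).
  (* Measurability of the partial unions is carried along, since subadditivity asks for it at each
     step. *)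
  have : measurable (\big[setU/set0]_i B i) /\ P (\big[setU/set0]_i B i) <= \sum_i P (B i).
    elim/big_rec2: _ => [|i y x _ [mx xy]]; first by rewrite measure0.
    split; first exact: measurableU.
    by apply: le_trans (measureU2 _ (mB i) mx) _; rewrite leeD2l.
  by case.
apply: le_trans (_ : \sum_(i : I) e%:E <= _); first exact: lee_sum.
by rewrite sumEFin sumr_const mulr_natl.
Qed.

End union_bound.

Lemma noise_threshold_le (R : realType) (N sigma l m : R) :
  0 < N -> 0 < sigma -> 0 < l -> 0 <= m ->
  2 * sigma / Num.sqrt N * Num.sqrt m <= l ->
  sigma ^+ 2 * (N * m) <= (N * l / 2) ^+ 2.
Proof.
move=> N0 s0 l0 m0 h.
have : (2 * sigma / Num.sqrt N * Num.sqrt m) ^+ 2 <= l ^+ 2.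
  rewrite ler_pXn2r ?nnegrE ?(ltW l0)//.
  by rewrite mulr_ge0 ?sqrtr_ge0// divr_ge0 ?sqrtr_ge0 ?mulr_ge0 ?ltW.
rewrite 2!exprMn exprVn !sqr_sqrtr ?(ltW N0)// => h2.
have := ler_wpM2l (sqr_ge0 (N / 2)) h2.
have -> : (N / 2) ^+ 2 * ((2 * sigma) ^+ 2 / N * m) = sigma ^+ 2 * (N * m).
  by field; rewrite gt_eqF.
have -> // : (N / 2) ^+ 2 * l ^+ 2 = (N * l / 2) ^+ 2.
by field.
Qed.

(** At x = q ln M each group fails with probability at most M^(- q), so the union over M groups
    costs M^(1 - q); the factor 2 in the conclusion is slack. *)
Lemma noise_event (R : realType) d (T : measurableType d) (P : probability T R)
    (N K M : nat) (G : 'I_M -> {set 'I_K}) (X : 'M[R]_(N, K))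
    (sigma q : R) (W : 'I_N -> {RV P >-> R}) (lam : 'I_M -> R) :
  is_group_partition G -> (0 < N)%N -> (1 < M)%N ->
  0 < sigma -> 0 < q -> iid_centered_normal W sigma ->
  (forall j, 0 < lam j) -> (forall j t, 0 < gram G X j t t) ->
  (forall j : 'I_M,
       2 * sigma / Num.sqrt N%:R
       * Num.sqrt (\tr (gram G X j)
                   + 2 * spectral_norm (gram G X j)
                     * (2 * q * ln M%:R
                        + Num.sqrt (#|G j|%:R * q * ln M%:R)))
       <= lam j) ->
  exists A : set T, [/\ measurable A,
    (forall w, A w -> forall j,
      enorm ((group_cols G X j)^T *m \col_i W i w) <= N%:R * lam j / 2) &
    ((1 - 2 * M%:R `^ (1 - q))%:E <= P A)%E].
Proof.
move=> hG N0 M1 s0 q0 iidW lam0 diag0 hlam.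
(* Having at least two groups makes x positive, as the tail bound requires. *)
have lnM : 0 < ln M%:R :> R by rewrite ln_gt0// ltr1n.
pose x := q * ln M%:R; have x0 : 0 < x by rewrite mulr_gt0.
pose m j := \tr (gram G X j) + 2 * spectral_norm (gram G X j)
  * (2 * x + Num.sqrt (#|G j|%:R * x)).
pose S j w := enorm ((group_cols G X j)^T *m \col_i W i w) ^+ 2.
pose B j := [set w | sigma ^+ 2 * (N%:R * m j) <= S j w]%classic.
have sn0 j : 0 < spectral_norm (gram G X j).
  exact: lt_le_trans (diag0 j (Ordinal (group_card_gt0 hG j))) (spectral_norm_ge_diag _ _).
have m0 j : 0 <= m j.
  rewrite addr_ge0//; first by rewrite sumr_ge0// => t _; exact: ltW.
  by rewrite mulr_ge0 ?mulr_ge0 ?addr_ge0 ?sqrtr_ge0 ?(ltW (sn0 j)) ?(ltW x0)// mulr_ge0 ?(ltW x0).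
have mS j : measurable_fun [set: T]%classic (S j).
  rewrite [X in measurable_fun _ X](_ : _ = fun w => \sum_t (\sum_i group_cols G X j i t * W i w) ^+ 2).
    apply: measurable_sum => t; apply: measurable_funX; apply: measurable_sum => i.
    exact: measurable_funM.
  apply/funext => w; rewrite /S sqr_enorm; apply: eq_bigr => t _.
  by rewrite expr2 mxE; congr (_ * _); apply: eq_bigr => i _; rewrite mxE [X in _ * X]mxE.
have mB j : measurable (B j).
  have := mS j measurableT `[sigma ^+ 2 * (N%:R * m j), +oo[%classic (measurable_itv _).
  rewrite setTI (_ : (_ @^-1` _)%classic = B j)//.
  by apply/seteqP; split => w /=; rewrite in_itv/= andbT.
have PB j : (P (B j) <= (expR (- x))%:E)%E.
  exact: (@gaussian_gram_tail _ _ _ _ _ _ _ iidW s0 _ (group_cols G X j) x N0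
    (group_card_gt0 hG j) x0 (sn0 j)).
have [A [mA AB PA]] := probability_avoid_ge mB PB.
exists A; split => //.
  move=> w /AB nB j; have {}nB := nB j.
  have lt : S j w < sigma ^+ 2 * (N%:R * m j) by rewrite ltNge; apply/negP.
  rewrite -(@ler_pXn2r _ 2) ?nnegrE ?enorm_ge0//; last first.
    by rewrite divr_ge0 ?mulr_ge0 ?(ltW (lam0 j)).
  apply: le_trans (ltW lt) _; apply: noise_threshold_le; rewrite ?ltr0n//.
  by have := hlam j; rewrite /m /x !mulrA.
apply: le_trans PA; rewrite lee_fin lerD2l lerN2 card_ord.
have -> : M%:R * expR (- x) = M%:R `^ (1 - q) :> R.
  rewrite /powR pnatr_eq0 gtn_eqF ?(ltnW M1)// mulrBl mul1r expRD lnK ?posrE ?ltr0n ?(ltnW M1)//.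
by rewrite ler_peMl ?powR_ge0// ler1n.
Qed.

(** * Deterministic error bounds on the noise event, and the theorem *)

Lemma GL_error_bounds (R : realType) (N K M s : nat) (G : 'I_M -> {set 'I_K})
    (X : 'M[R]_(N, K)) (lam : 'I_M -> R) (alpha phi : R)
    (bstar bhat : 'cV[R]_K) (w : 'cV[R]_N) :
  is_group_partition G -> (0 < N)%N -> (0 < M)%N -> (0 < s)%N ->
  (forall j, 0 < lam j) -> 1 < alpha -> 0 < phi ->
  coherence lam G X s alpha phi -> (#|group_supp G bstar| <= s)%N ->
  GL_solution lam G X (X *m bstar + w) bhat ->
  (forall j, enorm ((group_cols G X j)^T *m w) <= N%:R * lam j / 2) ->
  \sum_j enorm (group_block G (bhat - bstar) j)
    <= 16 * alpha / (alpha - 1) * (\sum_(j in group_supp G bstar) lam j ^+ 2)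
       / (phi * lambda_min lam) /\
  forall j, enorm (group_block G (bhat - bstar) j)
    <= gl_c alpha / phi * lambda_max lam.
Proof.
move=> hG N0 M0 s0 lam0 alpha1 phi0 coh sparse sol noise.
set J := group_supp G bstar in sparse *.
pose n j := enorm (group_block G (bhat - bstar) j).
pose Q := N%:R^-1 * enorm (X *m (bhat - bstar)) ^+ 2.
have n0 j : 0 <= n j by exact: enorm_ge0.
have Q0 : 0 <= Q by rewrite mulr_ge0 ?invr_ge0 ?ler0n ?sqr_ge0.
have basic := GL_basic_inequality hG N0 lam0 sol erefl noise.
have form := gram_form_ge hG N0 M0 lam0 alpha1 phi0 coh (bhat - bstar) J.
split.
  exact: (@sum_block_norm_le _ _ _ n J s alpha phi Q).
move=> j; apply: (@block_norm_le_lambda_max _ _ lam n J s alpha phi Q) => //.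
apply: (block_norm_le hG N0 M0 lam0 alpha1 phi0 coh).
exact: (GL_gram_error_le hG N0 lam0 sol erefl noise).
Qed.

Theorem corollary5p1 (R : realType) (d : measure_display)
    (T : measurableType d) (P : probability T R)
    (N K M s : nat) (hN : (1 <= N)%N) (hM : (2 <= M)%N) (hMK : (M <= K)%N)
    (hs : (1 <= s <= M)%N)
    (G : 'I_M -> {set 'I_K}) (hG : is_group_partition G)
    (X : 'M[R]_(N, K)) (bstar : 'cV[R]_K)
    (sigma : R) (hsigma : 0 < sigma)
    (W : 'I_N -> {RV P >-> R}) (hW : iid_centered_normal W sigma)
    (y : T -> 'cV[R]_N)
    (hy : forall w : T, y w = X *m bstar + \col_i W i w)
    (lam : 'I_M -> R) (hlam0 : forall j, 0 < lam j)
    (q : R) (hq : 0 < q)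
    (hlam : forall j : 'I_M,
       2 * sigma / Num.sqrt N%:R
       * Num.sqrt (\tr (gram G X j)
                   + 2 * spectral_norm (gram G X j)
                     * (2 * q * ln M%:R
                        + Num.sqrt (#|G j|%:R * q * ln M%:R)))
       <= lam j)
    (hsparse : (#|group_supp G bstar| <= s)%N)
    (hRE : RE lam G X s)
    (alpha phi : R) (halpha : 1 < alpha) (hphi : 0 < phi)
    (hcoh : coherence lam G X s alpha phi) :
  holds_with_prob_ge P (1 - 2 * M%:R `^ (1 - q))
    [set w : T | forall bhat : 'cV[R]_K, GL_solution lam G X (y w) bhat ->
       forall p : R, 1 <= p ->
       mixed_norm G p (bhat - bstar)
       <= gl_bound lam alpha phi p (group_supp G bstar)]%classic
  /\
  ((forall j : 'I_M, j \in group_supp G bstar ->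
      2 * gl_c alpha / phi * lambda_max lam < enorm (group_block G bstar j)) ->
   holds_with_prob_ge P (1 - 2 * M%:R `^ (1 - q))
     [set w : T | forall bhat : 'cV[R]_K, GL_solution lam G X (y w) bhat ->
        forall p : R, 1 <= p ->
        mixed_norm G p (bhat - bstar)
        <= gl_bound lam alpha phi p
             [set j : 'I_M | gl_c alpha / phi * lambda_max lam
                             < enorm (group_block G bhat j)]%SET]%classic).
Proof.
have N0 : (0 < N)%N by [].
have M0 : (0 < M)%N by exact: ltnW.
have /andP[s0 _] := hs.
have [diag _ _ _] := hcoh.
have [A [mA noise PA]] := noise_event (X := X) hG N0 hM hsigma hq hW hlam0
  (fun j t => eq_ind_r (fun y => 0 < y) hphi (diag j t)) hlam.
have bounds w bhat (Aw : A w) (sol : GL_solution lam G X (y w) bhat) :=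
  GL_error_bounds hG N0 M0 s0 hlam0 halpha hphi hcoh hsparse
    (eq_ind _ (fun u => GL_solution lam G X u bhat) sol _ (hy w)) (noise w Aw).
(* The event A is fixed before the solution and p, and it serves both claims. *)
split=> [|hbeta]; exists A; split => // w Aw bhat sol p p1;
  have [l1 linf] := bounds w bhat Aw sol.
  exact: mixed_norm_le_gl_bound.
(* Thresholding recovers the support: with tau = [gl_c alpha / phi * lambda_max lam], each block
   error is at most tau. On the support the estimated block keeps norm above 2 tau - tau; off it the
   block is pure error, which the strict threshold excludes. *)
rewrite (_ : [set j | _]%SET = group_supp G bstar); first exact: mixed_norm_le_gl_bound.
apply/setP => j; rewrite inE; have [jS|jS] := boolP (j \in group_supp G bstar).
  have := hbeta j jS; have := linf j.
  have : enorm (group_block G bstar j)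
      <= enorm (group_block G bhat j) + enorm (group_block G (bhat - bstar) j).
    rewrite -[enorm (group_block G (bhat - bstar) j)]enormN.
    have -> : group_block G bstar j = group_block G bhat j - group_block G (bhat - bstar) j.
      by rewrite group_blockB opprB addrC subrK.
    exact: enormD.
  have -> : 2 * gl_c alpha / phi * lambda_max lam
    = 2 * (gl_c alpha / phi * lambda_max lam) by ring.
  lra.
have b0 : group_block G bstar j = 0 by move: jS; rewrite inE negbK => /eqP.
by have := linf j; rewrite group_blockB b0 subr0 leNgt => /negbTE.
Qed.
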